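(* Let $\Gamma$ be a Gromov hyperbolic group, equipped with the word metric with respect to some finite generating set, and let $n=\dim\partial_\infty\Gamma$ be the topological (covering) dimension of its boundary at infinity. Then $\Gamma$ admits a quasi-isometric embedding into the product $T\times\dots\times T$ of $n+1$ copies of the binary metric tree $T$ (with, e.g., the $\ell_1$ product metric; all standard product metrics are bilipschitz equivalent).
   Context: A metric tree is a geodesic metric space in which every geodesic triangle is isometric to a (possibly degenerate) tripod. A simplicial metric tree is one admitting a triangulation; all edges are assumed to have length 1. The binary metric tree is the simplicial metric tree in which every vertex has valence exactly 3. A map $f:X\to Y$ between metric spaces is a quasi-isometric embedding if there are $a_1,a_2>0$, $b\ge0$ with $a_1|xx'|-b\le|f(x)f(x')|\le a_2|xx'|+b$ for all $x,x'\in X$. *)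

(* Defs.v *)
From mathcomp Require Import all_boot.
From Stdlib Require Import Reals.

Set Implicit Arguments.
Unset Strict Implicit.
Unset Printing Implicit Defensive.

Record GroupStr := {
  gcar :> Type;
  gmul : gcar -> gcar -> gcar;
  ginv : gcar -> gcar;
  gone : gcar;
  gmulA : forall x y z, gmul x (gmul y z) = gmul (gmul x y) z;
  gmul1 : forall x, gmul gone x = x;
  gmulV : forall x, gmul (ginv x) x = gone
}.

Section WordMetric.
Variable G : GroupStr.
Variable k : nat.
Variable S : 'I_k -> G.

Definition letter (l : bool * 'I_k) : G :=
  if l.1 then ginv (S l.2) else S l.2.

Definition eval_word (w : seq (bool * 'I_k)) : G :=
  foldr (fun l acc => gmul (letter l) acc) (gone G) w.

(* d is the word metric w.r.t. S: d x y is the least length of a word in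
   S ∪ S^{-1} representing x^{-1} y.  (This forces S to generate G.) *)
Definition is_word_metric (d : G -> G -> nat) : Prop :=
  forall x y m, d x y <= m <->
    exists w, size w <= m /\ eval_word w = gmul (ginv x) y.
End WordMetric.

(* Gromov products (doubled, to stay in nat) and hyperbolicity.         *)
Section Hyperbolic.
Variable X : Type.
Variable d : X -> X -> nat.

Definition gp2 (w x y : X) : nat := d w x + d w y - d x y.

Definition gromov_hyperbolic : Prop :=
  exists delta : nat, forall w x y z,
    minn (gp2 w x y) (gp2 w y z) <= gp2 w x z + 2 * delta.

Variable e : X.

Definition conv_infty (a : nat -> X) : Prop :=
  forall r, exists N, forall i j, N <= i -> N <= j -> r <= gp2 e (a i) (a j).

Definition gp_ev (a b : nat -> X) (r : nat) : Prop :=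
  exists N, forall i j, N <= i -> N <= j -> r <= gp2 e (a i) (b j).

(* Open subsets of the boundary (on representing sequences; open sets are
   automatically saturated for equivalence of sequences). *)
Definition bd_open (U : (nat -> X) -> Prop) : Prop :=
  forall a, conv_infty a -> U a ->
    exists r, forall b, conv_infty b -> gp_ev a b r -> U b.

Definition bd_cover_order_le (m : nat) : Prop :=
  forall (kU : nat) (U : 'I_kU -> (nat -> X) -> Prop),
    (forall i, bd_open (U i)) ->
    (forall a, conv_infty a -> exists i, U i a) ->
    exists (kV : nat) (V : 'I_kV -> (nat -> X) -> Prop),
      [/\ (forall j, bd_open (V j)),
          (forall a, conv_infty a -> exists j, V j a),
          (forall j, exists i, forall a, conv_infty a -> V j a -> U i a) &
          (forall J : {set 'I_kV}, m < #|J| ->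
             forall a, conv_infty a -> ~ (forall j, j \in J -> V j a))].

(* dim ∂X = n  <->  dim <= n and not dim <= n-1 *)
Definition bd_dim_eq (n : nat) : Prop :=
  bd_cover_order_le n.+1 /\ ~ bd_cover_order_le n.
End Hyperbolic.

(* The binary (3-regular) tree: vertices = reduced words over {0,1,2}
   (Cayley graph of Z/2 * Z/2 * Z/2), with the path metric.              *)
Definition tree_vertex (s : seq 'I_3) : bool :=
  sorted (fun a b => a != b) s.

Fixpoint lcp (s t : seq 'I_3) : nat :=
  match s, t with
  | a :: s', b :: t' => if a == b then (lcp s' t').+1 else 0
  | _, _ => 0
  end.

Definition tdist (s t : seq 'I_3) : nat := size s + size t - 2 * lcp s t.

Definition prod_tdist (m : nat) (u v : 'I_m -> seq 'I_3) : nat :=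
  \sum_(i < m) tdist (u i) (v i).

Open Scope R_scope.
Definition qi_embedding (A B : Type) (dA : A -> A -> nat) (dB : B -> B -> nat)
  (f : A -> B) : Prop :=
  exists a1 a2 b : R, 0 < a1 /\ 0 < a2 /\ 0 <= b /\
    forall x y, a1 * INR (dA x y) - b <= INR (dB (f x) (f y)) /\
                INR (dB (f x) (f y)) <= a2 * INR (dA x y) + b.
Close Scope R_scope.

(* Main.v *)
Require Import Defs.
From mathcomp Require Import all_boot.
From mathcomp Require Import boolp zify.
From Stdlib Require Import Reals Lra.

(* Fix a scale [Lam] and let the group elements [g] at distance a multiple of [Lam] from the
   identity play the role of small balls of the boundary. A fine cover of the boundary of order
   [n.+1] is turned into [n.+1] families of separated sets; translating it by [g] and restricting
   it to the shadow of [g] gives such families at the scale of [g]. A finite colouring of the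
   group refines the scales so that pieces of the same scale, colour and different centres are
   separated, and after enlarging each piece by the finer pieces it almost meets, every colour
   yields a laminar family. The pieces containing [x] then form a chain: it moves by a bounded
   amount when [x] moves to a neighbour, and between two diverging points every scale contributes
   to the chain of at least one colour. This embeds the group into [n.+1] trees.

   These trees have infinite valence, so the chain of [x] is recorded over a finite alphabet by
   a diary: every step of the chain writes down, last in first out, a bounded number of the
   pending letters describing where its pieces lie. A letter carries a local colour of the
   position, which separates diverging points, and a term of the period-doubling sequence, which
   forces the two diaries to be read in phase. Since some colour advances at a definite rate,
   diverging points have diaries that differ after a definite fraction of their length. *)

(** * Word metrics *)

Section WordMetricFacts.
Variables (G : GroupStr) (k : nat) (S : 'I_k -> G) (d : G -> G -> nat).
Hypothesis hd : is_word_metric S d.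

Local Notation e := (gone G).

Lemma gmulVr (x : G) : gmul x (ginv x) = e.
Proof.
rewrite -[LHS]gmul1 -{1}(gmulV (ginv x)) -gmulA.
by rewrite (gmulA (ginv x) x) gmulV gmul1 gmulV.
Qed.

Lemma gmul1r (x : G) : gmul x e = x.
Proof. by rewrite -(gmulV x) gmulA gmulVr gmul1. Qed.

Lemma gmulKV (x y : G) : gmul x (gmul (ginv x) y) = y.
Proof. by rewrite gmulA gmulVr gmul1. Qed.

Lemma gmulVK (x y : G) : gmul (ginv x) (gmul x y) = y.
Proof. by rewrite gmulA gmulV gmul1. Qed.

Lemma ginv_uniq (x y : G) : gmul x y = e -> y = ginv x.
Proof. by move=> h; rewrite -(gmulVK x y) h gmul1r. Qed.

Lemma ginvM (x y : G) : ginv (gmul x y) = gmul (ginv y) (ginv x).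
Proof. by apply/esym/ginv_uniq; rewrite -gmulA gmulKV gmulVr. Qed.

Lemma ginvK (x : G) : ginv (ginv x) = x.
Proof. by apply/esym/ginv_uniq; rewrite gmulV. Qed.

Lemma eval_cat w1 w2 :
  eval_word S (w1 ++ w2) = gmul (eval_word S w1) (eval_word S w2).
Proof. by elim: w1 => [|l w IH] /=; rewrite ?gmul1 // IH gmulA. Qed.

Lemma eval_inv w : exists2 w', size w' = size w & eval_word S w' = ginv (eval_word S w).
Proof.
elim: w => [|[b i] w [w' sw ew]]; first by exists [::] => //=; apply: ginv_uniq; rewrite gmul1.
exists (w' ++ [:: (~~ b, i)]); first by rewrite size_cat sw /= addn1.
rewrite eval_cat /= gmul1r ew ginvM; congr gmul.
by rewrite /letter; case: b => //=; rewrite ginvK.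
Qed.

Lemma dist_word x y : exists2 w, size w = d x y & eval_word S w = gmul (ginv x) y.
Proof.
have [w [sw ew]] := (hd x y (d x y)).1 (leqnn _).
exists w => //; apply/eqP; rewrite eqn_leq sw /=.
by apply/(hd x y (size w)).2; exists w.
Qed.

Lemma dist_le_word x y w : eval_word S w = gmul (ginv x) y -> d x y <= size w.
Proof. by move=> ew; apply/(hd x y (size w)).2; exists w. Qed.

Lemma wdistxx x : d x x = 0.
Proof. by apply/eqP; rewrite -leqn0; apply: (@dist_le_word x x [::]); rewrite /= gmulV. Qed.

Lemma wdistC x y : d x y = d y x.
Proof.
suff h a b : d a b <= d b a by apply/eqP; rewrite eqn_leq !h.
have [w sw ew] := dist_word b a; have [w' sw' ew'] := eval_inv w.
rewrite -sw -sw'; apply: dist_le_word; rewrite ew' ew ginvM; congr gmul.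
exact: ginvK.
Qed.

Lemma wdist_tri x y z : d x z <= d x y + d y z.
Proof.
have [w sw ew] := dist_word x y; have [w' sw' ew'] := dist_word y z.
rewrite -sw -sw' -size_cat; apply: dist_le_word.
by rewrite eval_cat ew ew' -gmulA gmulKV.
Qed.

Lemma wdist0_eq x y : d x y = 0 -> x = y.
Proof.
move=> h; have [w] := dist_word x y; rewrite h => /size0nil -> ew.
by rewrite -[LHS]gmul1r [X in gmul _ X]ew gmulKV.
Qed.

Lemma wdistMl g x y : d (gmul g x) (gmul g y) = d x y.
Proof.
have E : gmul (ginv (gmul g x)) (gmul g y) = gmul (ginv x) y.
  by rewrite ginvM -gmulA gmulVK.
apply/eqP; rewrite eqn_leq; apply/andP; split.
  have [w sw ew] := dist_word x y; rewrite -sw; apply: dist_le_word.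
  by rewrite E.
have [w sw ew] := dist_word (gmul g x) (gmul g y); rewrite -sw.
by apply: dist_le_word; rewrite -E.
Qed.

Lemma wdist_geod x y m : m <= d x y -> exists z, d x z = m /\ d z y = d x y - m.
Proof.
move=> hm; have [w sw ew] := dist_word x y.
exists (gmul x (eval_word S (take m w))).
have h1 : d x (gmul x (eval_word S (take m w))) <= m.
  apply: leq_trans (_ : size (take m w) <= m); last by rewrite size_take; case: ifP; lia.
  by apply: dist_le_word; rewrite gmulVK.
have h2 : d (gmul x (eval_word S (take m w))) y <= d x y - m.
  apply: leq_trans (_ : size (drop m w) <= d x y - m); last by rewrite size_drop sw.
  apply: dist_le_word; rewrite ginvM -gmulA -ew -{3}(cat_take_drop m w) eval_cat.
  by rewrite gmulVK.
have := wdist_tri x (gmul x (eval_word S (take m w))) y; lia.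
Qed.

(** Induction on the radius, splitting the last letter off a word. Membership is expressed through
    [nth] because the carrier is a bare type without an equality test. *)
Lemma finite_ball r :
  exists s : seq G, forall x, d e x <= r -> exists2 i, i < size s & nth e s i = x.
Proof.
elim: r => [|r [s hs]].
  exists [:: e] => x; rewrite leqn0 => /eqP /wdist0_eq <-; by exists 0.
exists (s ++ [seq gmul y (letter S l) | y <- s, l <- enum {: bool * 'I_k}]) => x hx.
have [le|lt] := leqP (d e x) r.
  by have [i hi <-] := hs x le; exists i; rewrite ?size_cat ?nth_cat ?hi //; lia.
have [w sw ew] := dist_word e x.
have {ew} ew : eval_word S w = x.
  by rewrite ew; have <- := ginv_uniq _ _ (gmul1 e); rewrite gmul1.
case/lastP: w sw ew => [|w l] /=; first lia.
rewrite size_rcons -cats1 eval_cat /= gmul1r => sw ew.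
have hy : d e (eval_word S w) <= r.
  apply: leq_trans (_ : size w <= r); last lia.
  by apply: dist_le_word; have <- := ginv_uniq _ _ (gmul1 e); rewrite gmul1.
have [i hi ei] := hs _ hy.
pose L := [seq gmul y (letter S l) | y <- s, l <- enum {: bool * 'I_k}].
suff [j hj ej] : exists2 j, j < size L & nth e L j = x.
  by exists (size s + j); rewrite ?size_cat ?ltn_add2l // nth_cat ifN; [rewrite addKn|lia].
have hl : index l (enum {: bool * 'I_k}) < size (enum {: bool * 'I_k}).
  by rewrite index_mem mem_enum.
(* Position of the product in the row-by-row list: row [i], column of the letter [l]. *)
exists (i * size (enum {: bool * 'I_k}) + index l (enum {: bool * 'I_k})).
  rewrite size_allpairs; apply: leq_trans (leq_mul hi (leqnn _)).
  by rewrite mulSn addnC ltn_add2r.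
rewrite -ew -ei /L -{2}[l](nth_index l (s := enum {: bool * 'I_k})) ?mem_enum //.
clear -hl hi; elim: s i hi => // y s IH [|i] hi /=.
  by rewrite mul0n add0n nth_cat size_map hl (nth_map l).
rewrite nth_cat size_map mulSn -addnA ifN ?addKn; last by lia.
exact: IH.
Qed.

Lemma group_injects_nat : exists idx : G -> nat, injective idx.
Proof.
have /choice[W hW] : forall x : G, exists w, eval_word S w = x.
  move=> x; have [w _ ew] := dist_word e x; exists w; rewrite ew.
  by have <- := ginv_uniq _ _ (gmul1 e); rewrite gmul1.
exists (fun x => pickle (W x)) => x y h.
by rewrite -(hW x) -(hW y); congr eval_word; apply: (pcan_inj pickleK).
Qed.

End WordMetricFacts.

(** * Colourings of graphs of bounded degree *)

Lemma exists_fresh (K : nat) (s : seq nat) : size s <= K -> exists2 m, m <= K & m \notin s.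
Proof.
move=> hs; apply: contrapT => h.
have sub : {subset iota 0 K.+1 <= s}.
  move=> m; rewrite mem_iota add0n => /andP[_ hm]; apply: contrapT => /negP hn.
  by apply: h; exists m.
by have := uniq_leq_size (iota_uniq 0 K.+1) sub; rewrite size_iota ltnNge hs.
Qed.

(* Greedy colouring along the enumeration [idx]. *)
Lemma bounded_degree_coloring (X : Type) (idx : X -> nat) (near : X -> X -> Prop) (K : nat) :
  injective idx ->
  (forall x y, near x y -> near y x) ->
  (forall x, exists2 s : seq nat, size s <= K & forall y, near x y -> idx y \in s) ->
  exists2 col : X -> nat, (forall x, col x <= K) &
    forall x y, x <> y -> near x y -> col x <> col y.
Proof.
move=> idxI nearC deg.
have /choice[F hF] : forall nc : nat * (nat -> nat), exists m, m <= K /\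
    forall x y, idx x = nc.1 -> near x y -> nc.2 (idx y) <> m.
  move=> [n c] /=; case: (pselect (exists x, idx x = n)) => [[x hx]|no]; last first.
    by exists 0; split=> // x y hx; case: no; exists x.
  have [s ss hs] := deg x.
  have [m hm hn] : exists2 m, m <= K & m \notin [seq c i | i <- s].
    by apply: exists_fresh; rewrite size_map.
  exists m; split=> // x' y; rewrite -hx => /idxI -> /hs hy em.
  by move/negP: hn; apply; rewrite -em map_f.
(* Stage [n] has settled the indices below [n], the others holding the default 0. Later stages keep
   settled values, so the final colour of index [i] is read at stage [i.+1]. *)
pose fix cols n : nat -> nat :=
  if n is n'.+1 then fun i => if i == n' then F (n', cols n') else cols n' i else fun=> 0.
have colsE n i : i < n -> cols n i = cols i.+1 i.
  elim: n => // n IH; rewrite ltnS leq_eqVlt => /orP[/eqP-> //|lt] /=.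
  by rewrite (ltn_eqF lt) IH //= eqxx.
have wlog_lt x y : idx x < idx y -> near x y ->
    cols (idx x).+1 (idx x) <> cols (idx y).+1 (idx y).
  move=> lt nxy; rewrite -(colsE (idx y)) // [cols (idx y).+1 _]/= eqxx.
  by have [_ h] := hF (idx y, cols (idx y)); apply: (h y x) => //; apply: nearC.
exists (fun x => cols (idx x).+1 (idx x)).
  by move=> x /=; rewrite eqxx; have [] := hF (idx x, cols (idx x)).
move=> x y ne nxy; case: (ltngtP (idx x) (idx y)) => [lt|lt|/idxI //].
  exact: wlog_lt.
by move=> h; apply: (wlog_lt y x lt (nearC _ _ nxy)); rewrite h.
Qed.

(** By left invariance every ball of radius [D] is a translate of the one at the identity, which
    bounds the degree. *)
Lemma word_metric_coloring (G : GroupStr) (k : nat) (S : 'I_k -> G) (d : G -> G -> nat) (D : nat) :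
  is_word_metric S d ->
  exists K, exists2 col : G -> nat, (forall x, col x <= K) &
    forall x y, x <> y -> d x y <= D -> col x <> col y.
Proof.
move=> hd; have [idx idxI] := group_injects_nat _ _ _ _ hd.
have [s hs] := finite_ball _ _ _ _ hd D.
exists (size s); apply: (@bounded_degree_coloring G idx (fun x y => d x y <= D)) => //.
  by move=> x y; rewrite (wdistC _ _ _ _ hd).
move=> x; exists [seq idx (gmul x z) | z <- s]; first by rewrite size_map.
move=> y hy; have [|i hi ei] := hs (gmul (ginv x) y).
  by rewrite -(wdistMl _ _ _ _ hd x) (gmul1r) gmulKV.
by rewrite -[y](gmulKV _ x) -ei -(nth_map _ 0 (fun z => idx (gmul x z))) // mem_nth // size_map.
Qed.

(** * Coloured covers from the dimension of the boundary *)

Section BoundaryCovers.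
Variables (X : Type) (d : X -> X -> nat) (e : X) (D : nat).
Hypothesis dxx : forall x, d x x = 0.
Hypothesis dC : forall x y, d x y = d y x.
Hypothesis dT : forall x y z, d x z <= d x y + d y z.
Hypothesis dgeod : forall x y m, m <= d x y -> exists z, d x z = m /\ d z y = d x y - m.
Hypothesis dball : forall r, exists s : seq X,
  forall x, d e x <= r -> exists2 i, i < size s & nth e s i = x.
Hypothesis dhyp : forall x y z, minn (gp2 d e x y) (gp2 d e y z) <= gp2 d e x z + D.

Local Notation gp := (gp2 d e).
(** Constant sequences allow points of the space and of the boundary to be compared by the same
    [gp_ev]. *)
Local Notation pt := (fun x => (fun _ : nat => x)).
Local Notation conv := (conv_infty d e).

Lemma gpC x y : gp x y = gp y x.
Proof. by rewrite /gp2 (dC x y) addnC. Qed.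

Lemma gp_le x y : gp x y <= 2 * d e x.
Proof. by rewrite /gp2; have := dT e x y; lia. Qed.

Lemma gp_geod p x : d e x = d e p + d p x -> gp p x = 2 * d e p.
Proof. by rewrite /gp2; lia. Qed.

Lemma gp_evC a b r : gp_ev d e a b r -> gp_ev d e b a r.
Proof. by move=> [N h]; exists N => i j hi hj; rewrite gpC; apply: h. Qed.

Lemma gp_evW a b r r' : r' <= r -> gp_ev d e a b r -> gp_ev d e a b r'.
Proof. by move=> hr [N h]; exists N => i j hi hj; apply: leq_trans hr (h i j hi hj). Qed.

Lemma gp_ev_trans b a c r : gp_ev d e a b (r + D) -> gp_ev d e b c (r + D) -> gp_ev d e a c r.
Proof.
move=> [N h] [M h']; exists (maxn N M) => i j hi hj.
have h1 := h i (maxn N M) ltac:(lia) ltac:(lia).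
have h2 := h' (maxn N M) j ltac:(lia) ltac:(lia).
by have := dhyp (a i) (b (maxn N M)) (c j); lia.
Qed.

Lemma gp_ev_pt x y r : gp_ev d e (pt x) (pt y) r <-> r <= gp x y.
Proof.
split=> [[N h]|h]; last by exists 0.
exact: (h N N (leqnn _) (leqnn _)).
Qed.

Lemma gp_ev_refl a r : conv a -> gp_ev d e a a r.
Proof. by move=> /(_ r) [N h]; exists N. Qed.

(* König's lemma: [a] is a geodesic ray such that every [a m] lies below infinitely many [x i]. *)
Lemma subsequence_limit (x : nat -> X) : (forall i, i <= d e (x i)) ->
  exists2 a, conv a & forall r N, exists2 i, N <= i & gp_ev d e a (pt (x i)) r.
Proof.
move=> hx; pose below g z := d e z = d e g + d g z.
pose inf g := forall N, exists2 i, N <= i & below g (x i).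
(* The sphere of radius [d e g + 1] is finite, so when infinitely many [x i] lie beyond [g],
   infinitely many of them lie beyond one of its points. Outside [inf] the value is a dummy. *)
have succ g : exists h, inf g -> [/\ inf h, d e h = (d e g).+1 & below g h].
  case: (pselect (inf g)) => [ig|]; last by move=> n; exists g.
  have [s hs] := dball (d e g).+1.
  apply: contrapT => no.
  have bad i : exists M, i < size s -> d e (nth e s i) = (d e g).+1 -> below g (nth e s i) ->
     forall j, M <= j -> ~ below (nth e s i) (x j).
    apply: contrapT => /forallNP H; apply: no; exists (nth e s i) => _.
    have h1 : [/\ d e (nth e s i) = (d e g).+1 & below g (nth e s i)].
      by apply: contrapT => H'; apply: (H 0) => ? ? ?; case: H'.
    case: h1 => h1 h2; split=> // N; apply: contrapT => H'; apply: (H N) => _ _ _ j hj bj.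
    by apply: H'; exists j.
  have /choice[M hM] := bad.
  have [i] := ig (maxn (d e g).+1 (\max_(i < size s) M i)).
  rewrite geq_max => /andP[hi1 hi2] bi.
  have dgx : 1 <= d g (x i) by have := hx i; move: bi; rewrite /below; lia.
  have [z [z1 z2]] := dgeod _ _ _ dgx.
  have dz : d e z = (d e g).+1.
    by move: bi; rewrite /below; have := dT e g z; have := dT e z (x i); lia.
  have [j hj ej] := hs z ltac:(lia).
  have := hM j hj; rewrite ej => /(_ dz); apply; [by rewrite /below; lia| |].
    exact: leq_trans (leq_bigmax (F := fun i : 'I__ => M i) (Ordinal hj)) hi2.
  by move: bi; rewrite /below; lia.
have /choice[sc hsc] := succ.
pose a m := iter m sc e.
have ha m : inf (a m) /\ d e (a m) = m.
  elim: m => [|m [IH1 IH2]].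
    by split=> [N|]; [exists N => //; rewrite /below dxx|rewrite /a /= dxx].
  by rewrite /a /=; have [h1 h2 h3] := hsc _ IH1; rewrite h2 IH2.
have below_trans g h z : below g h -> below h z -> below g z.
  by rewrite /below => h1 h2; have := dT g h z; have := dT e g z; lia.
have hb m p : below (a m) (a (m + p)).
  elim: p => [|p IH]; first by rewrite addn0 /below dxx addn0.
  by rewrite addnS; apply: below_trans IH _; have [h1 _] := ha (m + p); have [] := hsc _ h1.
have hgp m j : m <= j -> gp (a m) (a j) = 2 * m.
  by move=> hj; have := hb m (j - m); rewrite subnKC // => /gp_geod ->; rewrite (ha m).2.
exists a.
  move=> r; exists r => i j hi hj; case: (leqP i j) => h.
    by rewrite hgp //; lia.
  by rewrite gpC hgp //; lia.
move=> r N; have [i hi bi] := (ha (r + D)).1 N; exists i => //.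
apply: (@gp_ev_trans (pt (a (r + D)))).
  by exists (r + D) => j l hj _; rewrite gpC hgp //; lia.
by apply/gp_ev_pt; rewrite gp_geod // (ha _).2; lia.
Qed.

(** Compactness: points violating ever larger [R] accumulate at a boundary point, a whole
    neighbourhood of which lies in one member of the cover. *)
Lemma lebesgue_number kV (V : 'I_kV -> (nat -> X) -> Prop) :
  (forall j, bd_open d e (V j)) -> (forall a, conv a -> exists j, V j a) ->
  exists R, forall x, R <= 2 * d e x ->
    exists j, forall b, conv b -> gp_ev d e (pt x) b R -> V j b.
Proof.
move=> Vo Vc; apply: contrapT => no.
have /choice[x hx] : forall i, exists x, 2 * i <= 2 * d e x /\
    forall j, exists2 b, conv b & gp_ev d e (pt x) b (2 * i) /\ ~ V j b.
  move=> i; apply: contrapT => H; apply: no; exists (2 * i) => y hy.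
  apply: contrapT => H'; apply: H; exists y; split=> // j.
  apply: contrapT => H; apply: H'; exists j => b cb gb; apply: contrapT => nV.
  by apply: H; exists b.
have [a ca ha] := @subsequence_limit x ltac:(by move=> i; have [] := hx i; lia).
have [j Vj] := Vc a ca; have [r hr] := Vo j a ca Vj.
have [i hi gi] := ha (r + D) (r + D).
have [_ /(_ j)[b cb [gb]]] := hx i; apply; apply: hr => //.
by apply: gp_ev_trans gi _; apply: gp_evW gb; lia.
Qed.

(** The same compactness argument: a sequence of far counterexamples has a boundary point as a
    limit, which some of them see. *)
Lemma far_points_see_boundary R :
  exists R', forall x, R' <= 2 * d e x -> exists2 b, conv b & gp_ev d e (pt x) b R.
Proof.
apply: contrapT => no.
have /choice[x hx] : forall i, exists x, 2 * i <= 2 * d e x /\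
    forall b, conv b -> ~ gp_ev d e (pt x) b R.
  move=> i; apply: contrapT => H; apply: no; exists (2 * i) => y hy.
  apply: contrapT => H'; apply: H; exists y; split=> // b cb gb.
  by apply: H'; exists b.
have [a ca ha] := @subsequence_limit x ltac:(by move=> i; have [] := hx i; lia).
have [i _ gi] := ha R 0; have [_ /(_ a ca)] := hx i; apply.
exact: gp_evC.
Qed.

(** The cover consists of the shadows of the finitely many points of a ball. The quantifier over [q]
    takes the interior of a shadow, which makes it open. *)
Lemma fine_boundary_cover r : exists kU (U : 'I_kU -> (nat -> X) -> Prop),
  [/\ forall i, bd_open d e (U i), forall a, conv a -> exists i, U i a &
      forall i a b, conv a -> conv b -> U i a -> U i b -> gp_ev d e a b r].
Proof.
pose h := r + 3 * D; have [s hs] := dball h.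
pose U (i : 'I_(size s)) a := exists q, forall b, conv b -> gp_ev d e a b q ->
  gp_ev d e (pt (nth e s i)) b (r + D).
exists (size s), U; split.
- move=> i a ca [q hq]; exists (q + D) => b cb gab; exists (q + D) => c cc gbc.
  by apply: hq => //; apply: gp_ev_trans gab gbc.
- move=> a ca; have [N hN] := ca (2 * h).
  have hle : h <= d e (a N).
    by have := hN N N (leqnn _) (leqnn _); have := gp_le (a N) (a N); lia.
  have [g [g1 g2]] := dgeod _ _ _ hle.
  have [i hi ei] := hs g ltac:(lia).
  exists (Ordinal hi), (r + 3 * D) => b cb gab /=; rewrite ei.
  apply: gp_ev_trans (gp_evW _ _ _ _ _ gab); last by lia.
  apply: (@gp_ev_trans (pt (a N))).
    by apply/gp_ev_pt; rewrite gp_geod; lia.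
  exists N => _ j _ hj; have := hN N j (leqnn _) hj; lia.
move=> i a b ca cb [q hq] [q' hq'].
apply: gp_ev_trans (gp_evC _ _ _ (hq a ca _)) (hq' b cb _); exact: gp_ev_refl.
Qed.

(* [P t x] is the set of members of the boundary cover containing the ball of radius
   [exp (- (R0 + t D))] seen from [x]. Having at most [n.+1] elements, it cannot grow at all
   of the steps [t = 0, ..., n]; the colour of [x] is a step at which it is constant. *)
Lemma coloured_cover n r : bd_cover_order_le d e n.+1 ->
  exists R, exists L : 'I_n.+1 -> X -> option nat,
  [/\ forall c x y j, L c x = Some j -> L c y = Some j -> r <= gp x y,
      forall c x y i j, L c x = Some i -> L c y = Some j -> R <= gp x y -> i = j &
      forall x, R <= 2 * d e x -> exists c j, L c x = Some j].
Proof.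
move=> hdim; have [kU [U [Uo Uc Um]]] := fine_boundary_cover (r + 2 * D).
have [kV [V [Vo Vc VU Vord]]] := hdim kU U Uo Uc.
have [R0 hR0] := lebesgue_number kV V Vo Vc.
(* One step of [rad] is the error [D] of one change of centre, so nearby points have interleaved
   sets [P] ([Pshift]). *)
pose rad t := maxn R0 (r + 2 * D) + t * D.
have [R' hR'] := far_points_see_boundary (rad n.+1).
pose P t x : {set 'I_kV} :=
  [set j | `[< forall b, conv b -> gp_ev d e (pt x) b (rad t) -> V j b >]].
have Pmono t t' x : t <= t' -> P t x \subset P t' x.
  move=> ht; apply/subsetP=> j; rewrite !inE => /asboolP h; apply/asboolP=> b cb gb.
  by apply: h => //; apply: gp_evW gb; rewrite /rad; nia.
have Pshift t x y : t <= n -> rad n.+1 <= gp x y -> P t x \subset P t.+1 y.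
  move=> ht hxy; apply/subsetP=> j; rewrite !inE => /asboolP h; apply/asboolP=> b cb gb.
  apply: h => //; apply: (@gp_ev_trans (pt y)).
    by apply/gp_ev_pt; move: hxy; rewrite /rad; nia.
  by apply: gp_evW gb; rewrite /rad; lia.
pose R := maxn R' (rad n.+1).
(* The label of [x] is the set [P c x] itself, coded as a number. *)
pose L (c : 'I_n.+1) x :=
  if (R <= 2 * d e x) && (P c x == P c.+1 x) then Some (enum_rank (P c x) : nat) else None.
have LP c x j : L c x = Some j -> [/\ R <= 2 * d e x, P c x = P c.+1 x & enum_rank (P c x) = j :> nat].
  by rewrite /L; case: ifP => // /andP[h /eqP h'] [<-].
have P0 x : R <= 2 * d e x -> exists j, j \in P 0 x.
  move=> hx; have [|j hj] := hR0 x; first by move: hx; rewrite /R /rad; lia.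
  exists j; rewrite inE; apply/asboolP=> b cb gb; apply: hj => //.
  by apply: gp_evW gb; rewrite /rad; lia.
have rank_eq c x y i j : L c x = Some i -> L c y = Some j -> i = j <-> P c x = P c y.
  move=> /LP[_ _ <-] /LP[_ _ <-]; split=> [h|-> //].
  by apply: enum_rank_inj; apply: val_inj.
exists R, L; split.
- move=> c x y j h1 h2; have [_ /(_ erefl) E] := conj I (rank_eq _ _ _ _ _ h1 h2).1.
  have [hx _ _] := LP _ _ _ h1; have [hy _ _] := LP _ _ _ h2.
  (* Equal labels share a member [V i]. It contains boundary points seen from [x] and from [y], and
     these are close because [V i] refines the fine cover. *)
  have [i /(subsetP (Pmono 0 c x (leq0n _))) ix] := P0 x hx.
  have iy : i \in P c y by rewrite -E.
  have cn : rad c <= rad n.+1 by rewrite /rad; have := ltn_ord c; nia.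
  have [|a ca ga] := hR' x; first by move: hx; rewrite /R; lia.
  have [|b cb gb] := hR' y; first by move: hy; rewrite /R; lia.
  move: ix iy; rewrite !inE => /asboolP Hx /asboolP Hy.
  have Va : V i a by apply: Hx => //; apply: gp_evW ga.
  have Vb : V i b by apply: Hy => //; apply: gp_evW gb.
  have [u Hu] := VU i; have gab := Um _ _ _ ca cb (Hu _ ca Va) (Hu _ cb Vb).
  apply/gp_ev_pt; apply: (@gp_ev_trans a).
    by apply: gp_evW ga; rewrite /rad; lia.
  apply: (@gp_ev_trans b); first by apply: gp_evW gab; lia.
  by apply: gp_evC; apply: gp_evW gb; rewrite /rad; lia.
- move=> c x y i j h1 h2 hxy; apply/(rank_eq _ _ _ _ _ h1 h2).
  have [_ hx _] := LP _ _ _ h1; have [_ hy _] := LP _ _ _ h2.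
  have cn := ltn_ord c; have hr : rad n.+1 <= gp x y by move: hxy; rewrite /R; lia.
  (* Constancy at step [c] closes the interleaving: [P c x] lies in [P c.+1 y], which is [P c y],
     and symmetrically. *)
  apply/eqP; rewrite eqEsubset {2}hx {1}hy !Pshift //; first by rewrite gpC.
move=> x hx; apply: contrapT => no.
(* Without a colour, [P] would reach [n + 2] members, all containing any boundary point seen from
   [x], against the order of the cover. *)
have grow t : t <= n.+1 -> t < #|P t x|.
  elim: t => [_|t IH ht]; first by have [j hj] := P0 x hx; apply/card_gt0P; exists j.
  apply: leq_ltn_trans (IH (ltnW ht)) _; apply: proper_card.
  rewrite properEneq Pmono // andbT; apply/negP=> /eqP h; apply: no.
  by exists (Ordinal ht), (enum_rank (P t x)); rewrite /L /= hx h eqxx.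
have [|a ca ga] := hR' x; first by move: hx; rewrite /R; lia.
apply: (Vord _ (grow n.+1 (leqnn _)) a ca) => j; rewrite inE => /asboolP; exact.
Qed.

End BoundaryCovers.

(** * Laminar families *)

Lemma size_sorted_bounded (s : seq nat) m M :
  sorted ltn s -> (forall i, i \in s -> m <= i <= M) -> size s <= M.+1 - m.
Proof.
move=> ss hs; rewrite -(size_iota m (M.+1 - m)).
apply: uniq_leq_size; first by apply: sorted_uniq ss; [exact: ltn_trans | exact: ltnn].
by move=> i /hs; rewrite mem_iota; lia.
Qed.

(** * Common prefixes of chains sorted by level *)

Section SortedChains.
Variables (I : eqType) (lev : I -> nat).
Local Notation lt_lev := (fun v w => lev v < lev w).

Lemma lt_lev_trans : transitive lt_lev.
Proof. by move=> v u w; apply: ltn_trans. Qed.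

Lemma lev_lt_head v s w : sorted lt_lev (v :: s) -> w \in s -> lev v < lev w.
Proof. by move=> /(order_path_min lt_lev_trans)/allP; apply. Qed.

(** A common member pulls both heads into both chains. Each head is then the lowest member of both,
    so the heads coincide; hence chains with different heads are disjoint. *)
Lemma common_prefix (s t : seq I) :
  sorted lt_lev s -> sorted lt_lev t ->
  (forall v w, v \in s -> w \in s -> lev v < lev w -> w \in t -> v \in t) ->
  (forall v w, v \in t -> w \in t -> lev v < lev w -> w \in s -> v \in s) ->
  exists p s' t', [/\ s = p ++ s', t = p ++ t',
    forall v, v \in s' -> v \notin t & forall v, v \in t' -> v \notin s].
Proof.
elim: s t => [|v s IH] [|w t] ss st clos clos'.
- by exists [::], [::], [::].
- by exists [::], [::], (w :: t).
- by exists [::], (v :: s), [::].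
case: (eqVneq v w) => [E|ne].
  rewrite -E in st clos clos' *; have hs := lev_lt_head _ _ _ ss; have ht := lev_lt_head _ _ _ st.
  have [||u u' us us' lt ut|u u' us us' lt ut|p [s' [t' [Es Et h1 h2]]]] := IH t.
  + exact: path_sorted ss.
  + exact: path_sorted st.
  + have := clos u u'; rewrite !inE us us' ut !orbT => /(_ erefl erefl lt erefl) /orP[/eqP E'|//].
    by have := hs u us; rewrite E' ltnn.
  + have := clos' u u'; rewrite !inE us us' ut !orbT => /(_ erefl erefl lt erefl) /orP[/eqP E'|//].
    by have := ht u us; rewrite E' ltnn.
  exists (v :: p), s', t'; split; rewrite ?Es ?Et // => u hu.
    rewrite inE negb_or -Et h1 // andbT; apply/eqP=> E'.
    by have := hs u; rewrite E' ltnn Es mem_cat -E' hu orbT => /(_ erefl).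
  rewrite inE negb_or -Es h2 // andbT; apply/eqP=> E'.
  by have := ht u; rewrite E' ltnn Et mem_cat -E' hu orbT => /(_ erefl).
have none u : u \in v :: s -> u \in w :: t -> False.
  have vw : v \in w :: t -> w \in v :: s -> False.
    rewrite !inE (eq_sym w v) (negbTE ne) /= => vt ws.
    by have := lev_lt_head _ _ _ ss ws; have := lev_lt_head _ _ _ st vt; lia.
  move=> us ut; apply: vw.
    move: (us); rewrite inE => /orP[/eqP<- //|us'].
    by apply: clos ut => //; [rewrite inE eqxx|apply: lev_lt_head ss us'].
  move: (ut); rewrite inE => /orP[/eqP<- //|ut'].
  by apply: clos' us => //; [rewrite inE eqxx|apply: lev_lt_head st ut'].
exists [::], (v :: s), (w :: t); split=> // u hu; apply/negP=> hu'; by apply: (none u).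
Qed.

Lemma sorted_suffix (p s : seq I) : sorted lt_lev (p ++ s) -> sorted lt_lev s.
Proof. by case/cat_sorted2. Qed.

End SortedChains.

(** * The laminar hierarchy generated by separated families *)

Section Hierarchy.
Variables (X : Type) (gp : X -> X -> nat) (D : nat).
Hypothesis gpC : forall x y, gp x y = gp y x.
Hypothesis gp_self : forall x y, gp x y <= gp x x.
Hypothesis gp_hyp : forall x y z, minn (gp x y) (gp y z) <= gp x z + D.
(** Large [gp] means close: [a] controls the diameter of a member, [s] the separation of members of
    equal level, and each level is much finer than the previous one. *)
Variables (I : eqType) (lev : I -> nat) (mem : I -> X -> Prop) (a s : nat -> nat).
Hypothesis mesh : forall v x y, mem v x -> mem v y -> a (lev v) <= gp x y.
Hypothesis sep : forall v w x y, lev v = lev w -> mem v x -> mem w y ->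
  s (lev v) <= gp x y -> v = w.
Hypothesis a_le_s : forall l, a l <= s l.
Hypothesis s_lt_a : forall l, s l + 20 * D < a l.+1.
Hypothesis mem_far : forall v x, mem v x -> s (lev v) + 7 * D <= gp x x.

Definition nbhd w x := exists2 y, mem w y & s (lev w) + 4 * D <= gp x y.

Inductive link : I -> I -> Prop :=
| link_refl u : link u u
| link_step u z u' w : lev u < lev u' -> nbhd u z -> nbhd u' z -> link u' w -> link u w.

(** The first contact is at a point of [v] itself, not of its neighbourhood; this keeps the enlarged
    member close to [v] ([hat_near]). *)
Definition prec v w := exists z v1, [/\ lev v < lev v1, mem v z, nbhd v1 z & link v1 w].

(* Enlarging [v] by neighbourhoods of the finer members reachable from it makes the family
   laminar: see [prec_of_close] and [hat_thick]. *)
Definition hat v x := mem v x \/ exists2 w, prec v w & nbhd w x.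

Lemma s_lt_a_gen l m : l < m -> s l + 20 * D < a m.
Proof.
elim: m => // m IH; rewrite ltnS leq_eqVlt => /orP[/eqP->|/IH h]; first exact: s_lt_a.
have := s_lt_a m; have := a_le_s m; lia.
Qed.

Lemma link_trans u v w : link u v -> link v w -> link u w.
Proof. by elim=> // {u v} u z u' v lt n1 n2 _ IH /IH; apply: link_step lt n1 n2. Qed.

(** Errors do not accumulate along a link: the gap of [20 * D] to the next level absorbs whatever
    the finer part contributes, so the margin [3 * D] reproduces itself. *)
Lemma link_near u w x : link u w -> nbhd w x ->
  exists2 y, mem u y & s (lev u) + 3 * D <= gp x y.
Proof.
move=> lk; elim: lk x => {u w} [u|u z u' w lt n1 n2 _ IH] x nx.
  by case: nx => y my hy; exists y => //; lia.
have [y' my' hy'] := IH _ nx; case: n1 => y my hy; case: n2 => y'' my'' hy''.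
exists y => //; have := s_lt_a_gen _ _ lt; have := a_le_s (lev u').
have := mesh _ _ _ my' my''; have := gp_hyp x y' y''; have := gp_hyp x y'' z.
have := gp_hyp x z y; rewrite (gpC y'' z); lia.
Qed.

Lemma link_close u w x z : nbhd u z -> link u w -> nbhd w x -> a (lev u) <= gp x z + 2 * D.
Proof.
move=> [y my hy] lk nw; have [y' my' hy'] := link_near _ _ _ lk nw.
have := a_le_s (lev u); have := mesh _ _ _ my' my.
have := gp_hyp x y' y; have := gp_hyp x y z; rewrite (gpC y z); lia.
Qed.

Lemma hat_near v x : hat v x -> exists2 p, mem v p & s (lev v) + 7 * D <= gp x p.
Proof.
case=> [m|[w [z [v1 [lt mz n1 lk]]] nw]]; first by exists x => //; apply: mem_far.
exists z => //; have := link_close _ _ _ _ n1 lk nw; have := s_lt_a_gen _ _ lt; lia.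
Qed.

Lemma hat_far v x : hat v x -> s (lev v) + 7 * D <= gp x x.
Proof. by move/hat_near=> [p _ h]; apply: leq_trans h (gp_self _ _). Qed.

Lemma hat_mesh v x z : hat v x -> mem v z -> a (lev v) <= gp x z + D.
Proof.
move=> /hat_near[p mp hp] mz; have := mesh _ _ _ mp mz; have := a_le_s (lev v).
by have := gp_hyp x p z; lia.
Qed.

Lemma hat_mesh2 v x y : hat v x -> hat v y -> a (lev v) <= gp x y + 2 * D.
Proof.
move=> hx /hat_near[p mp hp]; have := hat_mesh _ _ _ hx mp; have := a_le_s (lev v).
by have := gp_hyp x p y; rewrite (gpC p y); lia.
Qed.

Lemma hat_inj v w x : lev v = lev w -> hat v x -> hat w x -> v = w.
Proof.
move=> E /hat_near[p mp hp] /hat_near[q mq hq]; apply: sep (E) mp mq _.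
by have := gp_hyp p x q; rewrite (gpC p x) E; rewrite E in hp; lia.
Qed.

Lemma mem_nbhd v x : mem v x -> nbhd v x.
Proof. by move=> m; exists x => //; have := mem_far _ _ m; lia. Qed.

Lemma prec_trans v w u : prec v w -> prec w u -> prec v u.
Proof.
move=> [z [v1 [lt mz n1 lk]]] [z' [v2 [lt' mz' n2 lk']]].
exists z, v1; split=> //; apply: link_trans lk _.
exact: link_step lt' (mem_nbhd _ _ mz') n2 lk'.
Qed.

Lemma prec_hat v w x : prec v w -> hat w x -> hat v x.
Proof.
move=> p [m|[u pu nu]]; right; first by exists w => //; apply: mem_nbhd.
by exists u => //; apply: prec_trans p pu.
Qed.

(** [hat v] contains the neighbourhood of every [w] reachable from [v], hence also the points close
    to [hat w] at the scale of [w]. *)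
Lemma hat_thick v w y z : prec v w -> hat w y -> s (lev w) + 7 * D <= gp y z -> hat v z.
Proof.
move=> p /hat_near[q mq hq] h; right; exists w => //; exists q => //.
by have := gp_hyp z y q; rewrite (gpC z y); lia.
Qed.

(** Follow the link until it passes the level of [w]. A link member of equal level is [w] by
    separation; a jump past that level happens at a point that is already in the neighbourhood of
    [w]. *)
Lemma link_of_close u w' w x q : link u w' -> nbhd w' x -> lev u < lev w ->
  mem w q -> s (lev w) + 6 * D <= gp x q -> link u w.
Proof.
move=> lk; elim: lk => {u w'} [u|u z u' w' lt n1 n2 lk IH] nx luw mq hq.
  by apply: link_step (link_refl w) => //; [exact: nx|exists q => //; lia].
case: (ltngtP (lev u') (lev w)) => [h|h|h].
- by apply: link_step lt n1 n2 _; apply: IH.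
- have := link_close _ _ _ _ n2 lk nx; have := s_lt_a_gen _ _ h => h1 h2.
  apply: link_step luw n1 _ (link_refl w); exists q => //.
  by have := gp_hyp z x q; rewrite (gpC z x); lia.
- have [y my hy] := link_near _ _ _ lk nx.
  rewrite -(sep _ _ _ _ h my mq); first exact: link_step lt n1 n2 (link_refl u').
  by have := gp_hyp y x q; rewrite (gpC y x) h; rewrite h in hy; lia.
Qed.

Lemma prec_of_close v w x y : lev v < lev w -> hat v x -> hat w y ->
  s (lev w) + 7 * D <= gp x y -> prec v w.
Proof.
move=> lt hv /hat_near[q mq hq] hxy.
have hxq : s (lev w) + 6 * D <= gp x q by have := gp_hyp x y q; lia.
case: hv => [m|[w' [z [v1 [lt1 mz n1 lk]]] nw]].
  by exists x, w; split=> //; [exists q => //; lia|exact: link_refl].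
case: (ltngtP (lev v1) (lev w)) => [h|h|h].
- by exists z, v1; split=> //; apply: link_of_close lk nw h mq hxq.
- have := link_close _ _ _ _ n1 lk nw; have := s_lt_a_gen _ _ h => h1 h2.
  exists z, w; split=> //; [exists q => //|exact: link_refl].
  by have := gp_hyp z x q; rewrite (gpC z x); lia.
- have [p mp hp] := link_near _ _ _ lk nw.
  exists z, v1; split=> //; rewrite -(sep _ _ _ _ h mp mq); first exact: link_refl.
  by have := gp_hyp p x q; rewrite (gpC p x) h; rewrite h in hp; lia.
Qed.

Lemma hat_comparable v w x : lev v < lev w -> hat v x -> hat w x -> prec v w.
Proof. by move=> lt hv hw; apply: prec_of_close lt hv hw (hat_far _ _ hw). Qed.

Lemma s_incr l m : l < m -> s l < s m.
Proof. by move=> /s_lt_a_gen; have := a_le_s m; lia. Qed.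

Lemma lev_le_s l : l <= s l.
Proof. by elim: l => // l IH; apply: leq_ltn_trans IH (s_incr _ _ _). Qed.

Definition is_chain x (c : seq I) :=
  sorted (fun v w => lev v < lev w) c /\ forall v, (v \in c) <-> hat v x.

(** There is at most one member per level by [hat_inj], and the levels are bounded because hats stay
    at depth at least [s]. *)
Lemma exists_chain x : exists c, is_chain x c.
Proof.
have H b : exists c, sorted (fun v w => lev v < lev w) c /\
    forall v, (v \in c) <-> (hat v x /\ lev v < b).
  elim: b => [|b [c [sc hc]]].
    by exists [::]; split=> // v; split=> // -[].
  case: (pselect (exists2 v, hat v x & lev v = b)) => [[v hv lv]|no].
    exists (rcons c v); split.
      case: c sc hc => // u c sc hc; rewrite /= rcons_path; apply/andP; split=> //.
      have /hc[_] : last u c \in u :: c by apply: mem_last.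
      by rewrite lv.
    move=> w; rewrite mem_rcons inE; split=> [/orP[/eqP->|/hc[h1 h2]]|[h1]].
    - by rewrite lv.
    - by split=> //; lia.
    rewrite ltnS leq_eqVlt => /orP[/eqP lw|lt]; last by apply/orP; right; apply/hc.
    by apply/orP; left; apply/eqP; apply: hat_inj h1 hv; rewrite lv.
  exists c; split=> // w; split=> [/hc[h1 h2]|[h1]]; first by split=> //; lia.
  rewrite ltnS leq_eqVlt => /orP[/eqP lw|lt]; last exact/hc.
  by case: no; exists w.
have [c [sc hc]] := H (gp x x).+1; exists c; split=> // v.
split=> [/hc[]//|hv]; apply/hc; split=> //.
by have := hat_far _ _ hv; have := lev_le_s (lev v); lia.
Qed.

Lemma chain_prefix x y cx cy : is_chain x cx -> is_chain y cy ->
  exists p ex ey, [/\ cx = p ++ ex, cy = p ++ ey,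
    forall v, v \in ex -> ~ hat v y & forall v, v \in ey -> ~ hat v x].
Proof.
move=> [sx hx] [sy hy].
have [||p [ex [ey [h1 h2 h3 h4]]]] := common_prefix _ lev cx cy sx sy.
- move=> v w /hx vx /hx wx lt /hy wy; apply/hy.
  by apply: prec_hat wy; apply: hat_comparable vx wx.
- move=> v w /hy vx /hy wx lt /hx wy; apply/hx.
  by apply: prec_hat wy; apply: hat_comparable vx wx.
exists p, ex, ey; split=> // v.
  by move=> /h3/negP h hv; apply: h; apply/hy.
by move=> /h4/negP h hv; apply: h; apply/hx.
Qed.

(** If [y] were close to [x] at the scale of [w], then [hat_thick] would put [y] into the hat of the
    coarser [v]. *)
Lemma chain_tail_fine x y c p v ex w : is_chain x c -> c = p ++ v :: ex ->
  ~ hat v y -> w \in ex -> gp x y < s (lev w) + 7 * D.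
Proof.
move=> [sc hc] E nv wex; rewrite ltnNge; apply/negP=> le; apply: nv.
have /hc hw : w \in c by rewrite E mem_cat inE wex !orbT.
have /hc hv : v \in c by rewrite E mem_cat inE eqxx orbT.
apply: hat_thick (hw) le; apply: hat_comparable hv hw.
by move: sc; rewrite E => /sorted_suffix/lev_lt_head; apply.
Qed.

(** Beyond its head, the tail has strictly increasing scales in a window from about [gp x y] to
    [gp x x]. *)
Lemma chain_tail_size x y c p ex : is_chain x c -> c = p ++ ex ->
  (forall v, v \in ex -> ~ hat v y) -> size ex <= gp x x - gp x y + 7 * D + 2.
Proof.
case: ex => // v ex hc E nex /=.
have fine w : w \in ex -> gp x y < s (lev w) + 7 * D.
  by apply: chain_tail_fine hc E _; apply: nex; rewrite inE eqxx.
have [sc hh] := hc.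
suff : size [seq s (lev w) | w <- ex] <= (gp x x).+1 - (gp x y - 7 * D).
  by rewrite size_map; have := gp_self x y; lia.
apply: size_sorted_bounded.
  rewrite sorted_map; apply: (sub_sorted (e := fun v w => lev v < lev w)).
    by move=> u w; apply: s_incr.
  by move: sc; rewrite E => /sorted_suffix/path_sorted.
move=> i /mapP[w wex ->]; have := fine w wex.
have /hh/hat_far : w \in c by rewrite E mem_cat inE wex !orbT.
lia.
Qed.

End Hierarchy.

(** * Diaries *)

(* The diary: a word [u1, u2, ...] of segments is rewritten over a bounded alphabet. Entry [i]
   pushes [ui] on a stack and then writes down and removes the [q] topmost letters. *)
Section Diary.
Variables (B : finType) (q : nat) (final : pred B) (bot : B).

Definition push (u : seq B) (st : nat -> B) : nat -> B :=
  fun t => if t < size u then nth bot u t else st (t - size u).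

Definition pop (st : nat -> B) : nat -> B := fun t => st (t + q).

Definition entry (st : nat -> B) : {ffun 'I_q -> B} := [ffun t : 'I_q => st t].

Fixpoint entries st us : seq {ffun 'I_q -> B} :=
  if us is u :: us' then entry (push u st) :: entries (pop (push u st)) us' else [::].

Definition stack st us := foldl (fun st u => pop (push u st)) st us.

Definition history st us := foldl (fun st u => push u st) st us.

(** Depth down to which the entries reveal the initial stack. Truncated subtraction gives 0 when the
    pushed segment alone covers what is read. *)
Fixpoint popped (us : seq (seq B)) : nat :=
  if us is u :: us' then q + popped us' - size u else 0.

Definition terminated (u : seq B) :=
  0 < size u /\ forall t, t < size u -> final (nth bot u t) = (t.+1 == size u).

Definition agree m (st st' : nat -> B) := forall t, t < m -> st t = st' t.

Lemma size_entries st us : size (entries st us) = size us.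
Proof. by elim: us st => //= u us IH st; rewrite IH. Qed.

Lemma entries_cat st us vs :
  entries st (us ++ vs) = entries st us ++ entries (stack st us) vs.
Proof. by elim: us st => //= u us IH st; rewrite IH. Qed.

Lemma entries_prefix st us n : take n (entries st us) = entries st (take n us).
Proof. by elim: us n st => [|u us IH] [|n] st //=; rewrite IH. Qed.

Lemma entry_pop_agree st st' m :
  entry st = entry st' -> agree m (pop st) (pop st') -> agree (q + m) st st'.
Proof.
move=> /ffunP E h t ht; case: (ltnP t q) => lt; first by have := E (Ordinal lt); rewrite !ffunE.
by have := h (t - q) ltac:(lia); rewrite /pop subnK.
Qed.

Lemma push_agree_size u u' st st' m : terminated u -> terminated u' ->
  agree m (push u st) (push u' st') -> size u <= m -> size u = size u'.
Proof.
move=> [u0 hu] [u0' hu'] h hm; rewrite /agree /push in h.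
have lt : (size u).-1 < size u by lia.
have := h (size u).-1 ltac:(lia); rewrite lt; case: ifP => lt' E.
  have := hu _ lt; rewrite E hu' // prednK // eqxx.
  by move/eqP.
have lt2 : (size u').-1 < size u' by lia.
have lt3 : (size u').-1 < size u by lia.
have := h (size u').-1 ltac:(lia); rewrite lt2 lt3 => E'.
have := hu' _ lt2; rewrite -E' hu // prednK // eqxx.
by move/eqP.
Qed.

(** The final letters act as delimiters: within the depth read, either both segments end at the same
    place or neither ends. *)
Lemma push_agree u u' st st' m : terminated u -> terminated u' ->
  agree m (push u st) (push u' st') ->
  (size u = size u' /\ agree (m - size u) st st') \/ (m < size u /\ m < size u').
Proof.
move=> tu tu' h; case: (leqP (size u) m) => hm.
  left; have E := push_agree_size _ _ _ _ _ tu tu' h hm; split=> // t ht.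
  have := h (t + size u) ltac:(lia); rewrite /push -E.
  by rewrite !ifN ?addnK // -leqNgt; lia.
right; split=> //; rewrite ltnNge; apply/negP=> hm'.
have h' : agree m (push u' st') (push u st) by move=> t ht; rewrite h.
by move: hm; rewrite -(push_agree_size _ _ _ _ _ tu' tu h' hm') ltnNge hm'.
Qed.

(** Decoding runs backwards: the last entries determine the stack before them, and each earlier
    entry restores the [q] letters it removed. *)
Lemma entries_agree st st' us us' :
  size us = size us' -> (forall u, u \in us -> terminated u) -> (forall u, u \in us' -> terminated u) ->
  entries st us = entries st' us' -> agree (popped us) st st'.
Proof.
move=> sz tu tu' E.
suff [_ h] : popped us = popped us' /\ agree (popped us) st st' by [].
elim: us us' st st' sz tu tu' E => [|u us IH] [|u' us'] st st' //= [sz] tu tu' [E1 E2].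
have [||P A] := IH _ _ _ sz _ _ E2.
- by move=> v hv; apply: tu; rewrite inE hv orbT.
- by move=> v hv; apply: tu'; rewrite inE hv orbT.
have := push_agree _ _ _ _ _ (tu u (mem_head _ _)) (tu' u' (mem_head _ _))
  (entry_pop_agree _ _ _ E1 A).
case=> [[<- h]|[h1 h2]]; rewrite -P; first by [].
move/ltnW: h1; move/ltnW: h2; rewrite -!subn_eq0 => /eqP-> /eqP->.
by split.
Qed.

(* The history forgets nothing: although [stack st us] lacks the letters written in earlier
   entries, these agree as well. *)
Lemma history_agree m st st' us us' :
  size us = size us' -> (forall u, u \in us -> terminated u) -> (forall u, u \in us' -> terminated u) ->
  entries st us = entries st' us' -> agree m (stack st us) (stack st' us') ->
  agree m (history st us) (history st' us').
Proof.
elim/last_ind: us us' m => [|us u IH]; case/lastP=> [|us' u'] m; rewrite ?size_rcons //.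
move=> [sz] tu tu'; rewrite -!cats1 !entries_cat /stack /history !foldl_cat /=.
move=> /eqP; rewrite eqseq_cat ?size_entries // => /andP[/eqP E1 /eqP[E2]] A.
have {}A := entry_pop_agree _ _ _ E2 A.
have tU : terminated u by apply: tu; rewrite mem_rcons mem_head.
have tU' : terminated u' by apply: tu'; rewrite mem_rcons mem_head.
have [[ES h]|[h1 h2]] := push_agree _ _ _ _ _ tU tU' A.
  have {}IH := IH us' _ sz _ _ E1 h; move=> t ht.
  rewrite /push -ES; case: ifP => lt.
    by have := A t ltac:(lia); rewrite /push -ES lt.
  apply: IH; last by lia.
  - by move=> v hv; apply: tu; rewrite mem_rcons inE hv orbT.
  - by move=> v hv; apply: tu'; rewrite mem_rcons inE hv orbT.
move=> t ht; have := A t ltac:(lia); rewrite /push.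
have hm n : q + m < n -> t < n by lia.
by rewrite (hm _ h1) (hm _ h2).
Qed.

Lemma popped_ge us : q * size us <= popped us + \sum_(u <- us) size u.
Proof. by elim: us => [|u us IH] /=; rewrite ?big_nil ?big_cons; lia. Qed.

(** The entries of [us2] write [q * size us2] letters; those not pushed during [us2] come from the
    stack left by [us1]. *)
Lemma diary_agree st us1 us2 us1' us2' :
  size us1 = size us1' -> size us2 = size us2' ->
  (forall u, u \in us1 ++ us2 -> terminated u) -> (forall u, u \in us1' ++ us2' -> terminated u) ->
  entries st (us1 ++ us2) = entries st (us1' ++ us2') ->
  agree (q * size us2 - \sum_(u <- us2) size u) (history st us1) (history st us1').
Proof.
move=> s1 s2 t1 t2; rewrite !entries_cat => /eqP; rewrite eqseq_cat ?size_entries //.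
move=> /andP[/eqP E1 /eqP E2].
have A : agree (popped us2) (stack st us1) (stack st us1').
  apply: entries_agree s2 _ _ E2 => u hu; [apply: t1|apply: t2]; by rewrite mem_cat hu orbT.
have H : agree (popped us2) (history st us1) (history st us1').
  apply: history_agree s1 _ _ E1 A => u hu; [apply: t1|apply: t2]; by rewrite mem_cat hu.
by move=> t ht; apply: H; apply: leq_trans ht _; rewrite leq_subLR addnC popped_ge.
Qed.

End Diary.

(* For [s = 2^e o] with [o] odd, take [i = 2^e u] where [u + o] is 2 modulo 4. *)
Lemma period_doubling_shift s m : 0 < s ->
  exists2 i, m < i <= m + 4 * s & odd (logn 2 i) != odd (logn 2 (i + s)).
Proof.
move=> s0; pose E := expn 2 (logn 2 s); pose o := s %/ E.
have E0 : 0 < E by rewrite /E expn_gt0.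
have sE : s = o * E by rewrite /o divnK // pfactor_dvdnn.
have oo : odd o.
  have := @pfactor_coprime 2 s isT s0 => -[o' co es].
  have -> : o = o' by rewrite /o {1}es mulnK.
  by rewrite coprime2n in co.
pose b := m %/ E.
have [u u4 [w ew]] : exists2 u, b < u <= b + 4 & exists w, u + o = 4 * w + 2.
  have := divn_eq (b.+1 + o) 4; have := ltn_pmod (b.+1 + o) (isT : 0 < 4).
  case: (_ %% 4) => [|[|[|[|//]]]] _ h; [exists (b + 3)|exists (b + 2)|exists (b + 1)|exists (b + 4)];
    try lia; [exists ((b.+1 + o) %/ 4)|exists ((b.+1 + o) %/ 4)|exists ((b.+1 + o) %/ 4)
             |exists ((b.+1 + o) %/ 4).+1]; lia.
have ou : odd u by have := congr1 odd ew; rewrite oddD oo (oddD (4 * w)) oddM addbT => /negbFE.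
have log0 v : odd v -> logn 2 v = 0.
  by move=> ov; rewrite lognE; case: ifP => // /and3P[_ _]; rewrite dvdn2 ov.
have lE : logn 2 E = logn 2 s by rewrite pfactorK.
exists (u * E).
  have Es : E <= s by apply: dvdn_leq => //; apply: pfactor_dvdnn.
  have /andP[b1 b2] := u4.
  have := leq_mul b1 (leqnn E); have := leq_mul b2 (leqnn E).
  have := divn_eq m E; have := ltn_pmod m E0; rewrite -/b mulSn mulnDl.
  move: (m %% E) (b * E) (u * E) => x y z; clear -Es; lia.
have -> : u * E + s = 2 * (2 * w + 1) * E by rewrite {1}sE -mulnDl ew; congr (_ * _); lia.
have u0 : 0 < u by case: (u) ou.
have ow : odd (2 * w + 1) by rewrite oddD oddM.
rewrite !lognM ?muln_gt0 ?addn1 // -?(addn1 (2 * w)) (log0 u) // (log0 (2 * w + 1)) //.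
by rewrite addn0 add0n oddD; case: (odd _).
Qed.

(** * Diaries of chains and the place where they differ *)

Section ChainDiary.
Variables (I : eqType) (lev : I -> nat) (m q : nat) (psi : I -> nat -> 'I_m).

Local Notation B := (option (bool * bool * 'I_m)).
Local Notation lt_lev := (fun v w => lev v < lev w).

Definition final_letter (b : B) := if b is Some (f, _, _) then f else false.

(** One letter for each level from [p] to [lev v], the finest on top. Level [l] has position [l.+1],
    so that the 2-adic valuation is taken of a positive number. *)
Definition segment (p : nat) (v : I) : seq B :=
  mkseq (fun t => Some (t.+1 == (lev v).+1 - p, odd (logn 2 ((lev v).+1 - t)), psi v (lev v - t)))
        ((lev v).+1 - p).

Fixpoint segments (p : nat) (c : seq I) : seq (seq B) :=
  if c is v :: c' then segment p v :: segments (lev v).+1 c' else [::].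

Definition top (p : nat) (c : seq I) := last p [seq (lev v).+1 | v <- c].

Definition bottom : nat -> B := fun=> None.

Definition diary c := entries B q None bottom (segments 0 c).

Lemma size_diary c : size (diary c) = size c.
Proof. by rewrite size_entries; elim: c (0) => //= v c IH p; rewrite IH. Qed.

Lemma size_segments p c : size (segments p c) = size c.
Proof. by elim: c p => //= v c IH p; rewrite IH. Qed.

Lemma segments_cat p c c' : segments p (c ++ c') = segments p c ++ segments (top p c) c'.
Proof. by elim: c p => //= v c IH p; rewrite IH. Qed.

Lemma diary_take i c : take i (diary c) = diary (take i c).
Proof.
rewrite /diary entries_prefix; congr entries.
by elim: c i (0) => [|v c IH] [|i] p //=; rewrite IH.
Qed.

Lemma diary_cat c c' : exists2 w, size w = size c' & diary (c ++ c') = diary c ++ w.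
Proof.
exists (entries B q None (stack B q None bottom (segments 0 c)) (segments (top 0 c) c')).
  by rewrite size_entries size_segments.
by rewrite /diary segments_cat entries_cat.
Qed.

Lemma segment_terminated p v : p <= lev v -> terminated B final_letter None (segment p v).
Proof.
move=> hp; split; first by rewrite size_mkseq; lia.
by move=> t; rewrite size_mkseq => ht; rewrite nth_mkseq.
Qed.

Lemma segments_terminated p c : all (fun v => p <= lev v) c -> sorted lt_lev c ->
  forall u, u \in segments p c -> terminated B final_letter None u.
Proof.
elim: c p => //= v c IH p /andP[hp _] pc u; rewrite inE => /orP[/eqP->|].
  exact: segment_terminated.
by apply: IH; [apply: order_path_min pc; exact: lt_lev_trans|exact: path_sorted pc].
Qed.

Lemma sum_size_segments p c : all (fun v => p <= lev v) c -> sorted lt_lev c ->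
  p + \sum_(u <- segments p c) size u = top p c.
Proof.
elim: c p => [|v c IH] p /=; first by rewrite big_nil addn0.
move=> /andP[hp _] pc; rewrite big_cons size_mkseq addnA subnKC; last by lia.
by apply: IH; [apply: order_path_min pc; exact: lt_lev_trans|exact: path_sorted pc].
Qed.

(** A history of height [T] shows position [T - t] at depth [t] and is exhausted below; the colour
    comes from a member of [P] at that level or a finer one. *)
Definition hist_spec (P : I -> Prop) (T : nat) (st : nat -> B) :=
  forall t, if t < T then exists v f, [/\ P v, T.-1 - t <= lev v &
      st t = Some (f, odd (logn 2 (T - t)), psi v (T.-1 - t))]
    else st t = None.

Lemma history_spec (P : I -> Prop) p c st :
  all (fun v => p <= lev v) c -> sorted lt_lev c -> (forall v, v \in c -> P v) ->
  hist_spec P p st -> hist_spec P (top p c) (history B None st (segments p c)).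
Proof.
elim: c p st => //= v c IH p st /andP[hp _] pc Pc hst.
apply: IH; [by apply: order_path_min pc; exact: lt_lev_trans|exact: path_sorted pc| |].
  by move=> u hu; apply: Pc; rewrite inE hu orbT.
move=> t; rewrite /push size_mkseq; case: (ltnP t ((lev v).+1 - p)) => ht.
  rewrite nth_mkseq // (_ : t < (lev v).+1); last by lia.
  exists v; eexists; split; [by apply: Pc; rewrite inE eqxx| |reflexivity] => /=; lia.
have := hst (t - ((lev v).+1 - p)).
case: (ltnP t (lev v).+1) => h1; case: ltnP => h2 //; try lia.
move=> [u [f [Pu hl ->]]]; exists u, f; split=> //=; first by lia.
have -> : p - (t - ((lev v).+1 - p)) = (lev v).+1 - t by lia.
by have -> : p.-1 - (t - ((lev v).+1 - p)) = lev v - t by lia.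
Qed.

(* Equal tops are told apart by the colours at level [l]; different tops by the
   period-doubling sequence. *)
Lemma hist_disagree P P' T T' st st' l Bd k :
  hist_spec P T st -> hist_spec P' T' st' -> l < T <= (l + Bd).+1 -> l < T' <= (l + Bd).+1 ->
  (forall v v', P v -> P' v' -> l <= lev v -> l <= lev v' -> psi v l <> psi v' l) ->
  agree B k st st' -> k <= 4 * Bd.
Proof.
wlog : P P' T T' st st' / T <= T' => [W|le] h h' hT hT' hpsi A.
  case: (leqP T T') => [le|/ltnW le]; first exact: (W P P' T T' st st').
  apply: (W P' P T' T st' st) => //; last by move=> t ht; rewrite A.
  by move=> v v' Pv Pv' h1 h2 E; apply: (hpsi v' v).
suff [t ht ne] : exists2 t, t <= 4 * Bd & st t <> st' t.
  by rewrite leqNgt; apply/negP=> lt; apply: ne; apply: A; apply: leq_ltn_trans lt.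
move: le; rewrite leq_eqVlt => /orP[/eqP E|lt].
  rewrite -E in h'; exists (T.-1 - l); first by lia.
  move: (h (T.-1 - l)) (h' (T.-1 - l)); rewrite !ifT; [|by lia|by lia].
  have -> : T.-1 - (T.-1 - l) = l by lia.
  by move=> [v [f [Pv hv ->]]] [v' [f' [Pv' hv' ->]]] [_]; apply: hpsi.
(* A low stack is exhausted at depth [T], where the higher one still has a letter. *)
pose s := T' - T; case: (leqP T (4 * s)) => hs.
  exists T; first by rewrite /s in hs; lia.
  by move: (h T) (h' T); rewrite ltnn lt => -> [v [f [_ _ ->]]].
(* Equal depths show positions differing by [s]; among the top [4 * s] letters the sequence detects
   this shift. *)
have [i hi ne] := period_doubling_shift s (T - 4 * s) ltac:(by rewrite /s; lia).
exists (T - i); first by rewrite /s in hi *; lia.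
move: (h (T - i)) (h' (T - i)); rewrite !ifT; [|by lia|by lia].
have -> : T - (T - i) = i by lia.
have -> : T' - (T - i) = i + s by rewrite /s; lia.
by move=> [v [f [_ _ ->]]] [v' [f' [_ _ ->]]] [_ E _]; rewrite E eqxx in ne.
Qed.

(** The diaries of [c2] push at most [Bd] letters, and the histories before them can agree only to
    depth [4 * Bd]; together this leaves [5 * Bd]. *)
Lemma diary_diverge c1 c2 c1' c2' l Bd :
  sorted lt_lev (c1 ++ c2) -> sorted lt_lev (c1' ++ c2') ->
  size c1 = size c1' -> size c2 = size c2' -> diary (c1 ++ c2) = diary (c1' ++ c2') ->
  l < top 0 c1 -> l < top 0 c1' ->
  (forall v, v \in c1 ++ c2 -> lev v <= l + Bd) -> (forall v, v \in c1' ++ c2' -> lev v <= l + Bd) ->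
  (forall v v', v \in c1 -> v' \in c1' -> l <= lev v -> l <= lev v' -> psi v l <> psi v' l) ->
  q * size c2 <= 5 * Bd.
Proof.
move=> sx sy z1 z2 E lx ly bx by_ hpsi.
have top_le c c' : (forall v, v \in c ++ c' -> lev v <= l + Bd) -> top 0 (c ++ c') <= (l + Bd).+1.
  move=> h; rewrite /top; case/lastP: (c ++ c') h => //= r v h.
  by rewrite map_rcons last_rcons ltnS h // mem_rcons mem_head.
have all0 c : all (fun v => 0 <= lev v) c by apply/allP.
have [sx1 sx2] := cat_sorted2 sx; have [sy1 _] := cat_sorted2 sy.
have := top_le _ _ bx; rewrite -(sum_size_segments _ _ (all0 _) sx) add0n.
rewrite segments_cat big_cat /= -(add0n (\sum_(u <- segments 0 c1) _)) sum_size_segments // => hsum.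
have A := diary_agree B q final_letter None bottom (segments 0 c1) (segments (top 0 c1) c2)
  (segments 0 c1') (segments (top 0 c1') c2').
rewrite !size_segments -!segments_cat in A.
have {}A := A z1 z2 (segments_terminated _ _ (all0 _) sx) (segments_terminated _ _ (all0 _) sy) E.
have B0 (P : I -> Prop) : hist_spec P 0 bottom by [].
have h1 := history_spec (fun v => v \in c1) 0 c1 bottom (all0 _) sx1 (fun _ h => h) (B0 _).
have h2 := history_spec (fun v => v \in c1') 0 c1' bottom (all0 _) sy1 (fun _ h => h) (B0 _).
have tx : l < top 0 c1 <= (l + Bd).+1.
  by rewrite lx /= -[c1]cats0; apply: top_le => v; rewrite cats0 => hv; apply: bx; rewrite mem_cat hv.
have ty : l < top 0 c1' <= (l + Bd).+1.
  by rewrite ly /= -[c1']cats0; apply: top_le => v; rewrite cats0 => hv; apply: by_; rewrite mem_cat hv.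
have := hist_disagree _ _ _ _ _ _ _ _ _ h1 h2 tx ty hpsi A.
move: hsum lx; clear; move: (\sum_(i <- _) _) => S.
lia.
Qed.

End ChainDiary.

(** * Encoding into the binary tree *)

Section TernaryCode.
Variable A : finType.

Definition mark (b : bool) : 'I_3 := inord (if b then 2 else 1).

Definition interleave0 (s : seq 'I_3) : seq 'I_3 := flatten [seq [:: ord0; x] | x <- s].

(** A one-hot word in the letters 1 and 2, separated by zeros so that no two neighbours are equal.
    All codes have the same length, so blocks stay aligned. *)
Definition code (a : A) : seq 'I_3 := interleave0 [seq mark (b == a) | b <- enum A].

Definition encode (w : seq A) : seq 'I_3 := flatten [seq code a | a <- w].

Lemma size_code a : size (code a) = 2 * #|A|.
Proof.
rewrite /code cardE; elim: (enum A) => //= b s IH; rewrite /interleave0 /= in IH *.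
by rewrite IH; lia.
Qed.

Lemma size_encode w : size (encode w) = 2 * #|A| * size w.
Proof.
by elim: w => [|a w IH] /=; rewrite ?muln0 // size_cat size_code [size _]IH mulnS.
Qed.

Lemma interleave0_inj : injective interleave0.
Proof. by elim=> [|x s IH] [|y t] //= [-> /IH ->]. Qed.

Lemma code_inj : injective code.
Proof.
move=> a b /interleave0_inj /eq_in_map /(_ a); rewrite mem_enum inE eqxx => /(_ erefl).
case: eqP => // _ /(congr1 val) /=; by rewrite !inordK.
Qed.

Lemma tree_vertex_encode w : tree_vertex (encode w).
Proof.
have mark0 b : mark b != ord0.
  by apply/negP=> /eqP/(congr1 val) /=; rewrite inordK; case: b.
have -> : encode w = interleave0 (flatten [seq [seq mark (b == a) | b <- enum A] | a <- w]).
  elim: w => //= a w IH; rewrite /encode /= [flatten _]IH /interleave0.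
  by rewrite map_cat flatten_cat.
suff H s : all (fun x => x != ord0) s -> sorted (fun a b : 'I_3 => a != b) (interleave0 s).
  by apply: H; apply/allP=> x /flatten_mapP[a _ /mapP[b _ ->]].
case: s => //= x s /andP[x0 hs]; rewrite eq_sym x0 /=.
elim: s x x0 hs => //= y s IH x x0 /andP[y0 hs].
by rewrite x0 eq_sym y0 /=; apply: IH.
Qed.

Lemma lcp_cat p s t : lcp (p ++ s) (p ++ t) = size p + lcp s t.
Proof. by elim: p => //= x p IH; rewrite eqxx IH. Qed.

Lemma lcp_le_size u v s t : size u = size v -> u <> v -> lcp (u ++ s) (v ++ t) <= size u.
Proof.
elim: u v => [|x u IH] [|y v] //= [sz] ne; case: eqP => // E.
by rewrite ltnS; apply: IH => // Ev; apply: ne; rewrite E Ev.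
Qed.

Lemma lcp_encode_ge p s t : 2 * #|A| * size p <= lcp (encode (p ++ s)) (encode (p ++ t)).
Proof. by rewrite /encode !map_cat !flatten_cat lcp_cat -size_encode leq_addr. Qed.

Lemma lcp_encode_le w w' : exists N, [/\ N <= size w, N <= size w', take N w = take N w' &
  lcp (encode w) (encode w') <= 2 * #|A| * N.+1].
Proof.
elim: w w' => [|a w IH] [|b w'].
- by exists 0.
- by exists 0.
- by exists 0; split=> //; rewrite /encode /=; case: (_ ++ _).
case: (eqVneq a b) => [<-|ne].
  have [N [h1 h2 h3 h4]] := IH w'; exists N.+1; split=> //=; first by rewrite h3.
  by rewrite /encode /= lcp_cat size_code mulnS leq_add2l.
exists 0; split=> //; rewrite muln1 -(size_code a); apply: lcp_le_size.
  by rewrite !size_code.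
by move/code_inj => E; rewrite E eqxx in ne.
Qed.

Lemma tdist_encode_le p s t :
  tdist (encode (p ++ s)) (encode (p ++ t)) <= 2 * #|A| * (size s + size t).
Proof.
rewrite /tdist !size_encode !size_cat; have := lcp_encode_ge p s t.
move: (2 * #|A|) (lcp _ _) => L m; nia.
Qed.

Lemma tdist_encode_ge w w' : 0 < #|A| -> exists N, [/\ N <= size w, N <= size w',
  take N w = take N w' & size w <= N + tdist (encode w) (encode w') + 2].
Proof.
move=> A0; have [N [h1 h2 h3 h4]] := lcp_encode_le w w'; exists N; split=> //.
rewrite /tdist !size_encode; move: h1 h2 h4 A0; clear.
move: (size w) (size w') (lcp _ _) #|A| => a b c L h1 h2 h3 h4.
suff : 2 * L * (a - N) + 2 * L * (b - N) <= 2 * L * a + 2 * L * b - 2 * c + 4 * L.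
  move: (2 * L * a + 2 * L * b - 2 * c) => E; nia.
nia.
Qed.

End TernaryCode.

(** * The embedding *)

Section Assembly.
Variables (G : GroupStr) (k : nat) (S : 'I_k -> G) (d : G -> G -> nat).
Hypothesis hd : is_word_metric S d.
Local Notation e := (gone G).
Local Notation gp := (gp2 d e).
Variables (D n N Lam : nat).
Hypothesis hyp : forall x y z, minn (gp x y) (gp y z) <= gp x z + D.
Variables (col : G -> nat) (r R : nat -> nat) (L : nat -> 'I_n.+1 -> G -> option nat).
Hypothesis col_lt : forall x, col x < N.
Hypothesis col_proper : forall x y, x <> y -> d x y <= 2 * D -> col x <> col y.
Hypothesis r_ge : forall b, D <= r b.
Hypothesis r_le_R : forall b, r b <= R b.
Hypothesis R_lt_r : forall b, R b + 20 * D < r b.+1.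
Hypothesis R_lt_Lam : forall b, b < N -> R b + 20 * D < 2 * Lam.
Hypothesis L_mesh : forall b c x y j, L b c x = Some j -> L b c y = Some j -> r b <= gp x y.
Hypothesis L_sep : forall b c x y i j,
  L b c x = Some i -> L b c y = Some j -> R b <= gp x y -> i = j.
Hypothesis L_cover : forall b x, R b <= 2 * d e x -> exists c j, L b c x = Some j.

Local Notation dxx := (wdistxx _ _ _ _ hd).
Local Notation dC := (wdistC _ _ _ _ hd).
Local Notation dT := (wdist_tri _ _ _ _ hd).
Local Notation I := {classic (gcar G * nat)}.

(** A level codes a radius [Lam * (l %/ N)] of centres and a colour [l %% N]; the scales of that
    colour are shifted by the doubled radius. *)
Definition mesh_scale l := 2 * Lam * (l %/ N) + r (l %% N).
Definition sep_scale l := 2 * Lam * (l %/ N) + R (l %% N).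
Definition level (v : I) : nat := (d e v.1 %/ Lam) * N + col v.1.

(* The pieces of the colour-[c] covers centred at [g], restricted to the shadow of [g]. *)
Definition member (c : 'I_n.+1) (v : I) (x : G) :=
  [/\ Lam %| d e v.1, d e x = d e v.1 + d v.1 x, L (col v.1) c (gmul (ginv v.1) x) = Some v.2
    & sep_scale (level v) + 7 * D <= gp x x].

Lemma N0 : 0 < N.
Proof. exact: leq_ltn_trans (leq0n _) (col_lt e). Qed.

Lemma Lam0 : 0 < Lam.
Proof. by have := R_lt_Lam 0 N0; lia. Qed.

Lemma level_div v : level v %/ N = d e v.1 %/ Lam.
Proof. by rewrite /level (divnMDl _ _ N0) (divn_small (col_lt _)) addn0. Qed.

Lemma level_mod v : level v %% N = col v.1.
Proof. by rewrite /level modnMDl (modn_small (col_lt _)). Qed.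

Lemma gpxx x : gp x x = 2 * d e x.
Proof. by rewrite /gp2 dxx; lia. Qed.

Lemma gp_sym x y : gp x y = gp y x.
Proof. exact: (gpC _ _ _ dC). Qed.

Lemma gp_selfle x y : gp x y <= gp x x.
Proof. by rewrite gpxx; exact: (gp_le _ _ _ dT). Qed.

Lemma gp_shadow g x y : d e x = d e g + d g x -> d e y = d e g + d g y ->
  gp x y = 2 * d e g + gp (gmul (ginv g) x) (gmul (ginv g) y).
Proof.
move=> hx hy; rewrite /gp2 -(wdistMl _ _ _ _ hd g e (gmul _ x)) -(wdistMl _ _ _ _ hd g e (gmul _ y)).
rewrite -(wdistMl _ _ _ _ hd g (gmul _ x) (gmul _ y)) gmul1r !gmulKV hx hy.
by have := dT x g y; rewrite (dC x g); lia.
Qed.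

Lemma scale_dvd v : Lam %| d e v.1 -> 2 * Lam * (level v %/ N) = 2 * d e v.1.
Proof. by move=> h; rewrite level_div -mulnA (mulnC Lam) divnK. Qed.

Lemma member_mesh c v x y : member c v x -> member c v y -> mesh_scale (level v) <= gp x y.
Proof.
move=> [dv hx Lx _] [_ hy Ly _]; rewrite /mesh_scale scale_dvd // level_mod.
by rewrite (gp_shadow _ _ _ hx hy) leq_add2l; apply: L_mesh Lx Ly.
Qed.

(** Equal levels give centres of equal radius and colour. Close members force these centres within
    [2 * D], so they coincide by [col_proper], and the separation of one translated cover
    applies. *)
Lemma member_sep c v w x y : level v = level w -> member c v x -> member c w y ->
  sep_scale (level v) <= gp x y -> v = w.
Proof.
move=> El [dv hx Lx _] [dw hy Ly _]; rewrite /sep_scale scale_dvd // level_mod => h.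
have Ed : d e v.1 = d e w.1.
  have := congr1 (fun l => l %/ N) El; rewrite !level_div => E.
  by rewrite -(divnK dv) -(divnK dw) E.
have Ec : col v.1 = col w.1 by rewrite -!level_mod El.
case: (pselect (v.1 = w.1)) => Eg; last first.
  exfalso; apply: (col_proper _ _ Eg) => //.
  have := gp_geod _ _ _ _ _ hx; have := gp_geod _ _ _ _ _ hy.
  have := hyp v.1 x y; have := hyp v.1 y w.1; rewrite (gp_sym y w.1).
  have : gp v.1 w.1 + d v.1 w.1 = 2 * d e v.1.
    by rewrite /gp2 -Ed; have := dT v.1 e w.1; rewrite (dC v.1 e) -Ed; lia.
  by rewrite -Ed; lia.
case: v w Eg hx hy Lx Ly h {El dv dw Ed Ec} => [g i] [g' j] /= <- hx hy Lx Ly h; congr (_, _).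
apply: L_sep Lx Ly _; move: h; rewrite (gp_shadow _ _ _ hx hy); lia.
Qed.

Lemma mesh_le_sep l : mesh_scale l <= sep_scale l.
Proof. by rewrite leq_add2l. Qed.

Lemma sep_lt_mesh l : sep_scale l + 20 * D < mesh_scale l.+1.
Proof.
have N_gt0 := N0; rewrite /sep_scale /mesh_scale.
have lt := ltn_pmod l N_gt0; rewrite (_ : l.+1 = l %/ N * N + (l %% N).+1); last by rewrite addnS -divn_eq.
case: (ltnP (l %% N).+1 N) => h.
  rewrite divnMDl // modnMDl (divn_small h) (modn_small h) addn0.
  by have := R_lt_r (l %% N); lia.
have -> : (l %% N).+1 = N by lia.
by rewrite divnMDl // modnMDl divnn modnn N_gt0; have := R_lt_Lam _ lt; lia.
Qed.

Lemma member_far c v x : member c v x -> sep_scale (level v) + 7 * D <= gp x x.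
Proof. by case. Qed.

Local Notation hatc c := (hat G gp D I level (member c) sep_scale).
Local Notation chainc c := (is_chain G gp D I level (member c) sep_scale).

Lemma exists_chainc c x : exists s, chainc c x s.
Proof.
exact: (@exists_chain G gp D gp_sym gp_selfle hyp I level (member c) mesh_scale sep_scale
  (member_mesh c) (member_sep c) mesh_le_sep sep_lt_mesh (member_far c)).
Qed.

Lemma chainc_prefix c x y cx cy : chainc c x cx -> chainc c y cy ->
  exists p ex ey, [/\ cx = p ++ ex, cy = p ++ ey,
    forall v, v \in ex -> ~ hatc c v y & forall v, v \in ey -> ~ hatc c v x].
Proof.
exact: (@chain_prefix G gp D gp_sym gp_selfle hyp I level (member c) mesh_scale sep_scale
  (member_mesh c) (member_sep c) mesh_le_sep sep_lt_mesh (member_far c)).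
Qed.

Lemma chainc_tail_fine c x y cx p v ex w : chainc c x cx -> cx = p ++ v :: ex ->
  ~ hatc c v y -> w \in ex -> gp x y < sep_scale (level w) + 7 * D.
Proof.
exact: (@chain_tail_fine G gp D gp_sym gp_selfle hyp I level (member c) mesh_scale sep_scale
  (member_mesh c) (member_sep c) mesh_le_sep sep_lt_mesh (member_far c)).
Qed.

Lemma chainc_tail_size c x y cx p ex : chainc c x cx -> cx = p ++ ex ->
  (forall v, v \in ex -> ~ hatc c v y) -> size ex <= 2 * d x y + 7 * D + 2.
Proof.
move=> h1 h2 h3.
have := (@chain_tail_size G gp D gp_sym gp_selfle hyp I level (member c) mesh_scale sep_scale
  (member_mesh c) (member_sep c) mesh_le_sep sep_lt_mesh (member_far c)) _ _ _ _ _ h1 h2 h3.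
rewrite gpxx /gp2; have := dT e y x; have := dT e x y; rewrite (dC y x); lia.
Qed.

Lemma hatc_far c v x : hatc c v x -> sep_scale (level v) + 7 * D <= 2 * d e x.
Proof.
rewrite -gpxx; exact: (@hat_far G gp D gp_sym gp_selfle hyp I level (member c) mesh_scale sep_scale
  (member_mesh c) mesh_le_sep sep_lt_mesh (member_far c)).
Qed.

Lemma hatc_nonempty c v x : hatc c v x -> exists z, member c v z.
Proof.
move=> hx; have [z mz _] := @hat_near G gp D gp_sym hyp I level (member c) mesh_scale sep_scale
  (member_mesh c) mesh_le_sep sep_lt_mesh (member_far c) _ _ hx.
by exists z.
Qed.

Lemma hatc_mesh c v x z : hatc c v x -> member c v z -> mesh_scale (level v) <= gp x z + D.
Proof.
exact: (@hat_mesh G gp D gp_sym hyp I level (member c) mesh_scale sep_scale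
  (member_mesh c) mesh_le_sep sep_lt_mesh (member_far c)).
Qed.

Lemma hatc_mesh2 c v x y : hatc c v x -> hatc c v y -> mesh_scale (level v) <= gp x y + 2 * D.
Proof.
exact: (@hat_mesh2 G gp D gp_sym hyp I level (member c) mesh_scale sep_scale
  (member_mesh c) mesh_le_sep sep_lt_mesh (member_far c)).
Qed.

(** The centre [g] is taken on a geodesic to [x] at radius [j * Lam]; the remaining distance, at
    least [Lam], exceeds what [L_cover] requires. *)
Lemma covered x j : (j.+1) * Lam <= d e x ->
  exists c v, hatc c v x /\ level v %/ N = j.
Proof.
move=> hj; have [g [g1 g2]] := wdist_geod _ _ _ _ hd e x (j * Lam) ltac:(lia).
have Rl := R_lt_Lam _ (col_lt g).
have [|c [i Lc]] := L_cover (col g) (gmul (ginv g) x).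
  rewrite -(wdistMl _ _ _ _ hd g) gmul1r gmulKV g2; lia.
exists c, ((g, i) : I); have lv : level (g, i) %/ N = j by rewrite level_div /= g1 mulnK // Lam0.
split=> //; left; split=> //=; first by rewrite g1 dvdn_mull.
  by rewrite g1 g2; lia.
by rewrite gpxx /sep_scale lv level_mod /=; lia.
Qed.


(** * The tree maps and their bounds *)

Variables (m : nat) (col' : G -> 'I_m) (center : 'I_n.+1 -> I -> G) (foot : nat -> G -> G).
Variable ch : 'I_n.+1 -> G -> seq I.
Hypothesis col'_proper : forall x y, x <> y -> d x y <= 2 * Lam + 6 * D -> col' x <> col' y.
Hypothesis centerP : forall c v x, member c v x -> member c v (center c v).
Hypothesis footP : forall h z, h <= d e z -> d e (foot h z) = h /\ d (foot h z) z = d e z - h.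
Hypothesis chP : forall c x, chainc c x (ch c x).

(** The local colour of the point where a geodesic to the centre of [v] crosses the sphere whose
    radius belongs to level [l]. *)
Definition psi c v l := col' (foot (Lam * (l %/ N)) (center c v)).
(** Large enough that the matched part of the diaries in [fine_count_le] is about half of the fine
    chain members at most. *)
Definition pace := 10 * N * n.+1.
Definition log c x := diary I level m pace (psi c) (ch c x).
Definition tree_map x c := encode _ (log c x).
Local Notation A := {ffun 'I_pace -> option (bool * bool * 'I_m)}.

Lemma center_foot c v x j : hatc c v x -> j * N <= level v ->
  2 * Lam * j <= gp (foot (Lam * j) (center c v)) x + D /\
  d e (foot (Lam * j) (center c v)) = Lam * j.
Proof.
move=> hv hj; have [z mz] := hatc_nonempty _ _ _ hv; have mc := centerP _ _ _ mz.
have hm := hatc_mesh _ _ _ _ hv mc; have jl : j <= level v %/ N by rewrite leq_divRL // N0.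
have hl : Lam * j <= Lam * (level v %/ N) by rewrite leq_mul2l jl orbT.
have hf := member_far _ _ _ mc.
rewrite gpxx /sep_scale -mulnA in hf; rewrite /mesh_scale -mulnA in hm.
have [f1 f2] := footP (Lam * j) (center c v) ltac:(lia); split=> //.
have gf : gp (foot (Lam * j) (center c v)) (center c v) = 2 * (Lam * j).
  by rewrite gp_geod ?f1 //; lia.
have := hyp (foot (Lam * j) (center c v)) (center c v) x.
by rewrite gf (gp_sym _ x) -mulnA; have := r_ge (level v %% N); lia.
Qed.

(** At the first radius clearly beyond the branching of [x] and [y] the two feet are distinct, yet
    within [2 * Lam + 6 * D], the range in which [col'] is injective. *)
Lemma psi_differs c x y v v' j :
  gp x y + 4 * D < 2 * Lam * j -> 2 * Lam * j <= gp x y + 4 * D + 2 * Lam ->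
  hatc c v x -> hatc c v' y -> j * N <= level v -> j * N <= level v' ->
  psi c v (j * N) <> psi c v' (j * N).
Proof.
move=> h1 h2 hx hy l1 l2; rewrite /psi mulnK ?N0 //.
have [a1 a2] := center_foot _ _ _ _ hx l1; have [b1 b2] := center_foot _ _ _ _ hy l2.
move: (foot _ (center c v)) (foot _ (center c v')) a1 a2 b1 b2 => p p' a1 a2 b1 b2.
rewrite -mulnA in h1 h2 a1 b1; apply: col'_proper.
  by move=> E; rewrite -E in b1; have := hyp x p y; rewrite (gp_sym x p); lia.
have : gp p p' + d p p' = 2 * (Lam * j).
  by rewrite /gp2 a2 b2; have := dT p e p'; rewrite (dC p e) a2 b2; lia.
have := hyp p x y; have := hyp p y p'; rewrite (gp_sym y p'); lia.
Qed.

Lemma path_last_level w s : path (fun v w => level v < level w) w s ->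
  level w + size s <= level (last w s).
Proof. by elim: s w => [|v s IH] w /=; [lia|move=> /andP[h /IH]; lia]. Qed.

(** The second tail member is already finer than [gp x y]; [3 * N] further members raise the level
    by three whole periods, which passes [j]. *)
Lemma level_reached c x y cx p ex j : chainc c x cx -> cx = p ++ ex ->
  (forall v, v \in ex -> ~ hatc c v y) -> 3 * N + 2 <= size ex ->
  2 * Lam * j <= gp x y + 4 * D + 2 * Lam ->
  j * N < top I level 0 (p ++ take (3 * N + 2) ex).
Proof.
move=> hc E nh sz hj; case: ex => [|v [|w s]] in E nh sz *; [move: sz => /=; lia..|].
have := chainc_tail_fine _ _ _ _ _ _ _ w hc E (nh v (mem_head _ _)) (mem_head _ _) => fine.
have [+ _] := hc; rewrite E => /cat_sorted2[_] /= /andP[_ pw].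
rewrite addn2 /= /top map_cat last_cat /= last_map ltnS.
have pt : path (fun v w => level v < level w) w (take (3 * N) s) by apply: take_path.
have := path_last_level _ _ pt; rewrite size_takel; last by move: sz => /=; lia.
move=> h; rewrite leqNgt; apply/negP=> lt.
have bj : (level w %/ N + 3) * N < j * N.
  by apply: leq_ltn_trans lt; apply: leq_trans h; have := leq_trunc_div (level w) N; lia.
rewrite ltn_mul2r N0 /= in bj.
have := R_lt_Lam _ (ltn_pmod (level w) N0); move: fine; rewrite /sep_scale.
have : 2 * Lam * (level w %/ N + 4) <= 2 * Lam * j by rewrite leq_mul2l; apply/orP; right; lia.
by rewrite mulnDr; lia.
Qed.

Lemma tree_map_upper c x y :
  tdist (tree_map x c) (tree_map y c) <= 2 * #|A| * (4 * d x y + 14 * D + 4).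
Proof.
have [p [ex [ey [E1 E2 h1 h2]]]] := chainc_prefix _ _ _ _ _ (chP c x) (chP c y).
rewrite /tree_map /log E1 E2.
have [wx sx ->] := diary_cat I level m pace (psi c) p ex.
have [wy sy ->] := diary_cat I level m pace (psi c) p ey.
apply: leq_trans (tdist_encode_le _ _ _ _) _; rewrite leq_mul2l; apply/orP; right.
have := chainc_tail_size _ _ _ _ _ _ (chP c x) E1 h1.
have := chainc_tail_size _ _ _ _ _ _ (chP c y) E2 h2.
rewrite sx sy (dC y x); lia.
Qed.


Lemma level_bound c x v : v \in ch c x -> level v < N * (d e x %/ Lam).+1.
Proof.
have [_ hc] := chP c x; move/hc/hatc_far; rewrite /sep_scale => h.
have h1 : level v %/ N <= d e x %/ Lam.
  by rewrite leq_divRL ?Lam0 // mulnC -(leq_pmul2l (isT : 0 < 2)) mulnA; lia.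
have := ltn_ceil (level v) N0; rewrite mulnC => h2; apply: leq_trans h2 _.
by rewrite leq_mul2l ltnS h1 orbT.
Qed.

Definition fine_count c x j := size [seq v <- ch c x | j * N <= level v].

(** Pigeonhole: every radius from [j] up to that of [x] is met by the chain of some colour, and the
    best colour gets at least the average. *)
Lemma many_fine_members x j : exists c, d e x %/ Lam - j <= n.+1 * fine_count c x j.
Proof.
have [c Ec] := eq_bigmax (fun c : 'I_n.+1 => fine_count c x j) ltac:(by rewrite card_ord).
exists c; pose t c := [seq level v %/ N | v <- [seq v <- ch c x | j * N <= level v]].
have sub : {subset iota j (d e x %/ Lam - j) <= flatten [seq t c | c <- enum 'I_n.+1]}.
  move=> i; rewrite mem_iota => /andP[ji hi].
  have lt : i < d e x %/ Lam by lia.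
  have [|c' [v [hv ev]]] := covered x i; first by rewrite -leq_divRL ?Lam0.
  apply/flatten_mapP; exists c'; first by rewrite mem_enum.
  apply/mapP; exists v => //; rewrite mem_filter; apply/andP; split.
    by rewrite -leq_divRL ?N0 // ev.
  by have [_ hc] := chP c' x; apply/hc.
have := uniq_leq_size (iota_uniq _ _) sub; rewrite size_iota => /leq_trans; apply.
rewrite size_flatten sumnE big_map big_map big_enum /=.
apply: leq_trans (_ : \sum_(c' < n.+1) fine_count c x j <= _).
  by apply: leq_sum => c' _; rewrite size_map -Ec; apply: (leq_bigmax (F := fun c => fine_count c x j)).
by rewrite sum_nat_const card_ord.
Qed.

(** The fine members of [ch c x] lie in its divergent tail. After [3 * N + 2] tail entries,
    [diary_diverge] lets the diaries agree for only about half the fine count more; the rest is paid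
    by the tree distance. *)
Lemma fine_count_le c x y j : d e y <= d e x ->
  gp x y + 4 * D < 2 * Lam * j -> 2 * Lam * j <= gp x y + 4 * D + 2 * Lam ->
  d e x %/ Lam - j <= n.+1 * fine_count c x j ->
  fine_count c x j <= 2 * tdist (tree_map x c) (tree_map y c) + 6 * N + 9.
Proof.
move=> yx j1 j2 hc.
have [p [ex [ey [Ex Ey h1 h2]]]] := chainc_prefix _ _ _ _ _ (chP c x) (chP c y).
have [sx hx] := chP c x; have [sy hy] := chP c y.
(* Members of the common prefix have both [x] and [y] in their hats, so they are coarser than level
   [j * N]. *)
have fc : fine_count c x j <= size ex.
  rewrite /fine_count Ex filter_cat size_cat.
  have -> : [seq v <- p | j * N <= level v] = [::].
    apply/eqP; rewrite -(negbK (_ == _)) -has_filter; apply/hasPn=> v vp.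
    have /hx vx : v \in ch c x by rewrite Ex mem_cat vp.
    have /hy vy : v \in ch c y by rewrite Ey mem_cat vp.
    have := hatc_mesh2 _ _ _ _ vx vy; rewrite /mesh_scale => hm.
    apply/negP; rewrite -leq_divRL ?N0 // => jl.
    have : 2 * Lam * j <= 2 * Lam * (level v %/ N) by rewrite leq_mul2l jl orbT.
    by lia.
  by rewrite /= size_filter count_size.
have A0 : 0 < #|A| by apply/card_gt0P; exists [ffun=> None].
have [M [M1 M2 M3 M4]] := tdist_encode_ge _ (log c x) (log c y) A0.
rewrite -/(tree_map x c) -/(tree_map y c) in M4; move: (tdist _ _) M4 => td.
rewrite /log !size_diary in M1 M2 *; rewrite {1}Ex size_cat => M4.
pose i0 := size p + (3 * N + 2); case: (leqP M i0) => Mi0; first by rewrite /i0 in Mi0; lia.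
have t0 z ez : z = p ++ ez -> M <= size z ->
    take M z = (p ++ take (3 * N + 2) ez) ++ take (M - i0) (drop (3 * N + 2) ez) /\
    3 * N + 2 <= size ez.
  move=> -> hM; rewrite size_cat in hM; split; last by rewrite /i0 in Mi0; lia.
  rewrite take_cat ifN; last by rewrite -leqNgt; rewrite /i0 in Mi0; lia.
  rewrite -catA; congr (_ ++ _); rewrite (_ : M - size p = 3 * N + 2 + (M - i0)) ?takeD //.
  by rewrite /i0 in Mi0 *; lia.
have [tx szx] := t0 _ _ Ex M1; have [ty szy] := t0 _ _ Ey M2.
rewrite /log !diary_take tx ty in M3.
have szd z ez : z = p ++ ez -> M <= size z -> size (take (M - i0) (drop (3 * N + 2) ez)) = M - i0.
  by move=> -> hM; rewrite size_cat in hM; rewrite size_takel // size_drop /i0; rewrite /i0 in Mi0; lia.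
have lt_level_take z : sorted (fun v w => level v < level w) z ->
    sorted (fun v w => level v < level w) (take M z) by apply: take_sorted.
(* Number of levels above [j * N] available to either chain, [y] being no farther from the identity
   than [x]. *)
pose Bd := N * (d e x %/ Lam - j).+1.
have lb z v : d e z <= d e x -> v \in ch c z -> level v <= j * N + Bd.
  move=> hz hv; apply: ltnW; apply: leq_trans (level_bound _ _ _ hv) _.
  have := leq_div2r Lam hz; rewrite /Bd (mulnC j) -mulnDr leq_mul2l => h.
  by apply/orP; right; lia.
have mem_take z v : v \in take M (ch c z) -> v \in ch c z by apply: mem_take.
have := diary_diverge I level m pace (psi c) (p ++ take (3 * N + 2) ex)
  (take (M - i0) (drop (3 * N + 2) ex)) (p ++ take (3 * N + 2) ey)
  (take (M - i0) (drop (3 * N + 2) ey)) (j * N) Bd.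
rewrite -tx -ty in M3 *.
rewrite (szd _ _ Ex M1) (szd _ _ Ey M2) !size_cat !size_takel // => H.
have {}H : pace * (M - i0) <= 5 * Bd.
  apply: H => //.
  - exact: lt_level_take.
  - exact: lt_level_take.
  - exact: level_reached (chP c x) Ex h1 szx j2.
  - by apply: level_reached (chP c y) Ey h2 szy _; rewrite gp_sym.
  - by move=> v /mem_take; apply: lb.
  - by move=> v /mem_take; apply: lb.
  move=> v v' hv hv'; apply: (psi_differs c x y) => //.
    by apply/hx; apply: mem_take; rewrite tx mem_cat hv.
  by apply/hy; apply: mem_take; rewrite ty mem_cat hv'.
have {}H : 2 * (M - i0) <= fine_count c x j + 1.
  move: H hc; rewrite /pace /Bd; move: (_ %/ _ - _) (fine_count c x j) (M - i0) => K F Q.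
  have N_gt0 := N0; clear -N_gt0 => H hc.
  have H1 : 2 * n.+1 * Q <= K.+1.
    by rewrite -(leq_pmul2l (_ : 0 < 5 * N)) ?muln_gt0 //; lia.
  rewrite leqNgt; apply/negP=> lt.
  have : n.+1 * (F + 2) <= n.+1 * (2 * Q) by rewrite leq_mul2l; apply/orP; right; lia.
  by rewrite mulnDr; lia.
rewrite /i0 in H Mi0; lia.
Qed.

(** With [j] the first radius beyond the branching of [x] and [y], the distance [d x y] is
    controlled by the radii between [j] and that of [x], hence by the fine count of one colour. *)
Lemma tree_map_lower x y : d e y <= d e x ->
  d x y <= 2 * Lam * (n.+1 * (2 * prod_tdist (tree_map x) (tree_map y) + 6 * N + 9)) + 4 * Lam + 4 * D.
Proof.
move=> yx; have Lam_gt0 := Lam0; pose j := ((gp x y + 4 * D) %/ (2 * Lam)).+1.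
have j1 : gp x y + 4 * D < 2 * Lam * j by rewrite [2 * Lam * j]mulnC /j ltn_ceil // muln_gt0.
have j2 : 2 * Lam * j <= gp x y + 4 * D + 2 * Lam.
  by rewrite /j mulnSr [2 * Lam * _]mulnC leq_add2r leq_trunc_div.
have [c hc] := many_fine_members x j.
have hf := fine_count_le c x y j yx j1 j2 hc.
have ht : tdist (tree_map x c) (tree_map y c) <= prod_tdist (tree_map x) (tree_map y).
  by rewrite /prod_tdist (bigD1 c) //= leq_addr.
have hK : d e x %/ Lam - j <= n.+1 * (2 * prod_tdist (tree_map x) (tree_map y) + 6 * N + 9).
  by apply: leq_trans hc _; rewrite leq_mul2l; apply/orP; right; lia.
move: (n.+1 * _) hK => W hK.
have hdx := ltn_ceil (d e x) Lam_gt0.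
have h3 : (d e x %/ Lam).+1 * Lam <= (j + W).+1 * Lam by rewrite leq_mul2r; apply/orP; right; lia.
have : d x y + gp x y <= 2 * d e x by rewrite /gp2; have := dT x e y; rewrite (dC x e); lia.
move: j2 hdx h3; clear; nia.
Qed.

End Assembly.

(** * From the two bounds to the quasi-isometric embedding *)

Lemma qi_embedding_nat (X Y : Type) (dX : X -> X -> nat) (dY : Y -> Y -> nat) (f : X -> Y)
    (C1 C2 C3 C4 : nat) : 0 < C1 -> 0 < C3 ->
  (forall x y, dX x y <= C1 * dY (f x) (f y) + C2) ->
  (forall x y, dY (f x) (f y) <= C3 * dX x y + C4) -> qi_embedding dX dY f.
Proof.
move=> p1 p3 h1 h2.
have P1 : (0 < INR C1)%R by apply: lt_0_INR; apply/ltP.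
have P3 : (0 < INR C3)%R by apply: lt_0_INR; apply/ltP.
have P1' := Rinv_0_lt_compat _ P1.
have P4 := pos_INR C4; have P2 := pos_INR C2.
exists (/ INR C1)%R, (INR C3), (/ INR C1 * INR C2 + INR C4)%R.
split=> //; split=> //; split.
  by have := Rmult_le_pos _ _ (Rlt_le _ _ P1') P2; lra.
move=> x y.
have H1 : (INR (dX x y) <= INR C1 * INR (dY (f x) (f y)) + INR C2)%R.
  by rewrite -mult_INR -plus_INR; apply: le_INR; apply/leP; apply: h1.
have H2 : (INR (dY (f x) (f y)) <= INR C3 * INR (dX x y) + INR C4)%R.
  by rewrite -mult_INR -plus_INR; apply: le_INR; apply/leP; apply: h2.
have := Rmult_le_pos _ _ (Rlt_le _ _ P1') P2.
have := Rmult_le_compat_l _ _ _ (Rlt_le _ _ P1') H1.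
rewrite Rmult_plus_distr_l -Rmult_assoc Rinv_l; last by lra.
by split; lra.
Qed.

Lemma tdistC s t : tdist s t = tdist t s.
Proof.
have lcpC : lcp s t = lcp t s.
  by elim: s t => [|a s IH] [|b t] //=; rewrite eq_sym IH.
by rewrite /tdist lcpC (addnC (size s)).
Qed.

Theorem theorem1p1 (G : GroupStr) (k : nat) (S : 'I_k -> G)
  (d : G -> G -> nat) (hd : is_word_metric S d)
  (hhyp : gromov_hyperbolic d)
  (n : nat) (hdim : bd_dim_eq d (gone G) n) :
  exists f : G -> ('I_n.+1 -> seq 'I_3),
    (forall x i, tree_vertex (f x i)) /\
    qi_embedding d (@prod_tdist n.+1) f.
Proof.
have [hdim' _] := hdim; have [del hdel] := hhyp; pose D := 2 * del.
have hyp := hdel (gone G); rewrite -/D in hyp.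
have [K [col colK col_proper]] := word_metric_coloring G k S d (2 * D) hd.
have /choice[Rf /choice[Lf hRL]] := fun r => @coloured_cover G d (gone G) D (wdistxx _ _ _ _ hd)
  (wdistC _ _ _ _ hd) (wdist_tri _ _ _ _ hd) (wdist_geod _ _ _ _ hd) (finite_ball _ _ _ _ hd)
  hyp n r hdim'.
(* The scales are chosen recursively: each colour starts [20 * D] beyond the separation scale of the
   previous one, and [Lam] is taken beyond all of them. *)
pose fix r b := if b is b'.+1 then maxn (Rf (r b')) (r b') + 20 * D + 1 else D.
pose R b := maxn (Rf (r b)) (r b); pose L b := Lf (r b).
pose Lam := \max_(b < K.+1) R b + 20 * D + 1.
have col_lt x : col x < K.+1 by rewrite ltnS.
have r_ge b : D <= r b by case: b => //= b; lia.
have r_le_R b : r b <= R b by rewrite /R; lia.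
have R_lt_r b : R b + 20 * D < r b.+1 by rewrite /R /=; lia.
have R_lt_Lam b : b < K.+1 -> R b + 20 * D < 2 * Lam.
  move=> hb; have h : R b <= \max_(b < K.+1) R b.
    exact: (leq_bigmax (F := fun b : 'I_K.+1 => R b) (Ordinal hb)).
  by rewrite /Lam; move: (\max_(b < _) _) h => M h; lia.
have L_mesh b c x y j : L b c x = Some j -> L b c y = Some j -> r b <= gp2 d (gone G) x y.
  by have [h _ _] := hRL (r b); apply: h.
have L_sep b c x y i j : L b c x = Some i -> L b c y = Some j ->
    R b <= gp2 d (gone G) x y -> i = j.
  by have [_ h _] := hRL (r b) => h1 h2 h3; apply: h h1 h2 _; rewrite /R in h3; lia.
have L_cover b x : R b <= 2 * d (gone G) x -> exists c j, L b c x = Some j.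
  by have [_ _ h] := hRL (r b) => h3; apply: h; rewrite /R in h3; lia.
have [K' [col' colK' col'_proper]] := word_metric_coloring G k S d (2 * Lam + 6 * D) hd.
pose mem := member G d D n K.+1 Lam col R L.
have /choice[center centerP] : forall cv : 'I_n.+1 * {classic (gcar G * nat)}, exists z,
    forall x, mem cv.1 cv.2 x -> mem cv.1 cv.2 z.
  move=> [c v] /=; case: (pselect (exists z, mem c v z)) => [[z hz]|no].
    by exists z.
  by exists (gone G) => x hx; case: no; exists x.
have /choice[foot footP] : forall hz : nat * G, exists p, hz.1 <= d (gone G) hz.2 ->
    d (gone G) p = hz.1 /\ d p hz.2 = d (gone G) hz.2 - hz.1.
  move=> [h z] /=; case: (leqP h (d (gone G) z)) => hle; last by exists z.
  by have [p hp] := wdist_geod _ _ _ _ hd _ _ _ hle; exists p.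
have /choice[ch chP] := fun cx : 'I_n.+1 * G =>
  exists_chainc G k S d hd D n K.+1 Lam hyp col r R L col_lt col_proper r_le_R R_lt_r
    R_lt_Lam L_mesh L_sep cx.1 cx.2.
pose col'' x : 'I_K'.+1 := inord (col' x).
have col''_proper x y : x <> y -> d x y <= 2 * Lam + 6 * D -> col'' x <> col'' y.
  move=> ne le /(congr1 val) /=; rewrite !inordK ?ltnS //; exact: col'_proper.
pose f := tree_map G d n K.+1 Lam col K'.+1 col'' (fun c v => center (c, v))
  (fun h z => foot (h, z)) (fun c x => ch (c, x)).
have lower : forall x y, d (gone G) y <= d (gone G) x -> _ :=
  tree_map_lower G k S d hd D n K.+1 Lam hyp col r R L col_lt col_proper r_ge r_le_R R_lt_r
    R_lt_Lam L_mesh L_sep L_cover K'.+1 col'' (fun c v => center (c, v))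
    (fun h z => foot (h, z)) (fun c x => ch (c, x)) col''_proper (fun c v => centerP (c, v))
    (fun h z => footP (h, z)) (fun c x => chP (c, x)).
have upper := tree_map_upper G k S d hd D n K.+1 Lam hyp col r R L col_lt col_proper r_le_R
    R_lt_r R_lt_Lam L_mesh L_sep K'.+1 col'' (fun c v => center (c, v))
    (fun h z => foot (h, z)) (fun c x => ch (c, x)) (fun c x => chP (c, x)).
rewrite -/f in lower upper.
have prodC x y : prod_tdist (f x) (f y) = prod_tdist (f y) (f x).
  by apply: eq_bigr => i _; apply: tdistC.
exists f; split; first by move=> x i; apply: tree_vertex_encode.
pose A := #|{ffun 'I_(pace n K.+1) -> option (bool * bool * 'I_K'.+1)}|.
have A0 : 0 < A by apply/card_gt0P; exists [ffun=> None].
apply: (@qi_embedding_nat _ _ _ _ _ (4 * Lam * n.+1)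
  (2 * Lam * (n.+1 * (6 * K.+1 + 9)) + 4 * Lam + 4 * D)
  (n.+1 * (2 * A * 4)) (n.+1 * (2 * A * (14 * D + 4)))).
- by rewrite !muln_gt0 /= /Lam addn1.
- by rewrite !muln_gt0 A0.
- move=> x y.
  suff h : d x y <= 2 * Lam * (n.+1 * (2 * prod_tdist (f x) (f y) + 6 * K.+1 + 9)) + 4 * Lam + 4 * D.
    by apply: leq_trans h _; move: (prod_tdist _ _) (Lam) => P M; clear; lia.
  case: (leqP (d (gone G) y) (d (gone G) x)) => [/lower //|/ltnW/lower].
  by rewrite (wdistC _ _ _ _ hd x y) prodC.
move=> x y; apply: leq_trans (_ : \sum_(i < n.+1) 2 * A * (4 * d x y + 14 * D + 4) <= _).
  by apply: leq_sum => i _; apply: upper.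
rewrite sum_nat_const card_ord; move: (d x y) (D) (A) => t E B; clear; lia.
Qed.
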